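(* Let $(a_n)$ be a sequence of nonnegative numbers which is regular and has level of distribution $1$. For a parameter $x$, let $u$ be a random integer with $\mathbb{P}(u=m) = \frac{a_m}{N(x)}\mathbf{1}[1\le m\le x]$, and let $p_1\ge p_2\ge\cdots$ be the prime factors of $u$ listed with multiplicity, with $p_j = 1$ if $u$ has fewer than $j$ prime factors. Then for every $k\ge1$ and all fixed $c_1,\dots,c_k\in[0,\infty)$, $$\mathbb{P}\Big(\frac{\log p_1}{\log u}\le c_1,\dots,\frac{\log p_k}{\log u}\le c_k\Big) \to \mathbb{P}(L_1\le c_1,\dots,L_k\le c_k)$$ as $x\to\infty$; that is, the process $\frac{\log p_1}{\log u},\frac{\log p_2}{\log u},\dots$ converges in distribution to the Poisson–Dirichlet process $L_1, L_2,\dots$.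
   Context: For a sequence $(a_n)_{n\ge1}$ of nonnegative numbers, define $N(x) = \sum_{n\leq x} a_n$ and $N_d(x) = \sum_{n\leq x,\ d\mid n} a_n$. $\mathbf{1}[\mathfrak{A}]$ is $1$ if $\mathfrak{A}$ holds and $0$ otherwise, and $\Omega(d)$ is the number of prime factors of $d$ counted with multiplicity. The sequence is regular if for every fixed $c<1$, $N(x^c) = o(N(x))$ as $x\to\infty$. It has level of distribution $\vartheta$ if there is a multiplicative function $g$ with $g(d)\in[0,1]$ for all $d\ge1$, $\sum_{p\le x} g(p)\log p = \log x + O(1)$ (sum over primes), and $g(d) = O(C^{\Omega(d)}/d)$ for some constant $C\ge1$, such that for every $0<c<\vartheta$ and every $A>0$, $\sum_{d\le x^c} |N_d(x) - g(d)N(x)| \ll_{c,A} N(x)/(\log x)^A$. Convention: $\log 1/\log 1 = 1$ (for the case $u=1$). The Poisson–Dirichlet process (parameter $\theta=1$): let $U_1,U_2,\dots$ be i.i.d. uniform on $(0,1)$, set $G_1 = 1-U_1$, $G_j = U_1\cdots U_{j-1}(1-U_j)$ for $j\ge2$; then $L_1\ge L_2\ge\cdots$ is the nonincreasing rearrangement of $G_1,G_2,\dots$. *)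

(* Defs.v *)
From HB Require Import structures.
From mathcomp Require Import all_boot all_order all_algebra.
From mathcomp Require Import all_classical all_reals all_analysis.

Set Implicit Arguments.
Unset Strict Implicit.
Unset Printing Implicit Defensive.

Import Order.TTheory GRing.Theory Num.Theory.
Import numFieldNormedType.Exports.

Local Open Scope classical_set_scope.
Local Open Scope ring_scope.

(* Lets the Landau notations be used with x --> +oo. *)
Canonical pinfty_filter_on (R : realType) :=
  FilterType (pinfty_nbhs R) _.

(* A sequence (a_n)_{n >= 1} is a function a : nat -> R whose value at 0 is
   never used.  For x >= 0, a sum over 1 <= n <= x is a sum over
   1 <= n < (Num.truncn x).+1. *)

Definition seqN (R : realType) (a : nat -> R) (x : R) : R :=
  \sum_(1 <= n < (Num.truncn x).+1) a n.

Definition seqNd (R : realType) (a : nat -> R) (d : nat) (x : R) : R :=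
  \sum_(1 <= n < (Num.truncn x).+1 | (d %| n)%N) a n.

Definition regular_seq (R : realType) (a : nat -> R) : Prop :=
  forall c : R, c < 1 -> (fun x : R => seqN a (x `^ c)) =o_ (pinfty_nbhs R) (seqN a).

(* Prime factors with multiplicity, in nonincreasing order. *)
Definition prime_factors (n : nat) : seq nat :=
  sort geq (flatten [seq nseq pe.2 pe.1 | pe <- prime_decomp n]).

Definition bigOmega (n : nat) : nat := size (prime_factors n).

Definition multiplicative (R : realType) (g : nat -> R) : Prop :=
  g 1%N = 1 /\
  forall m n : nat, (0 < m)%N -> (0 < n)%N -> coprime m n ->
    g (m * n)%N = g m * g n.

Definition has_level_of_distribution (R : realType) (a : nat -> R)
    (theta : R) : Prop :=
  exists g : nat -> R,
    [/\ multiplicative g,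
        forall d : nat, (0 < d)%N -> 0 <= g d <= 1,
        (fun x : R =>
           \sum_(1 <= p < (Num.truncn x).+1 | prime p) g p * ln p%:R - ln x)
          =O_ (pinfty_nbhs R) (fun=> 1 : R),
        exists2 C : R, 1 <= C &
          g =O_\oo (fun d : nat => C ^+ bigOmega d / d%:R)
      & forall c A : R, 0 < c -> c < theta -> 0 < A ->
          (fun x : R => \sum_(1 <= d < (Num.truncn (x `^ c)).+1)
                          `|seqNd a d x - g d * seqN a x|)
            =O_ (pinfty_nbhs R) (fun x : R => seqN a x / ln x `^ A)].

(* The probability that u \in E, where u is the random integer with
   P(u = m) = a_m / N(x) for 1 <= m <= x (meaningful when N(x) > 0). *)
Definition pmf_u (R : realType) (a : nat -> R) (x : R) (m : nat) : R :=
  a m / seqN a x.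

Definition prob_u (R : realType) (a : nat -> R) (x : R) (E : set nat) : R :=
  \sum_(1 <= m < (Num.truncn x).+1) pmf_u a x m * \1_E m.

(* Indices start at 0: nth_prime_factor j u is p_{j+1}. *)
Definition nth_prime_factor (j u : nat) : nat := nth 1%N (prime_factors u) j.

(* log p_{j+1} / log u, with the convention log 1 / log 1 = 1. *)
Definition log_ratio (R : realType) (j u : nat) : R :=
  if u == 1%N then 1 else ln (nth_prime_factor j u)%:R / ln u%:R.

Definition mutually_independent d (T : measurableType d) (R : realType)
    (P : probability T R) (X : nat -> {RV P >-> R}) : Prop :=
  forall (J : seq nat) (B : nat -> set R),
    uniq J -> (forall j, measurable (B j)) ->
    P (\bigcap_(j in [set` J]) (X j @^-1` B j)) =
    (\prod_(j <- J) P (X j @^-1` B j))%E.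

Definition iid_uniform d (T : measurableType d) (R : realType)
    (P : probability T R) (U : nat -> {RV P >-> R}) : Prop :=
  mutually_independent U /\
  forall (j : nat) (B : set R), measurable B ->
    distribution P (U j) B = uniform_prob (@ltr01 R) B.

(* Index j here is index j + 1 in G_1 = 1 - U_1,
   G_j = U_1 ... U_{j-1} (1 - U_j). *)
Definition stick_breaking (R : realType) (U : nat -> R) (j : nat) : R :=
  (\prod_(i < j) U i) * (1 - U j).

Definition nonincreasing_rearrangement (R : realType) (G L : nat -> R) : Prop :=
  (forall i j : nat, (i <= j)%N -> L j <= L i) /\
  exists2 sigma : nat -> nat, bijective sigma & forall j, L j = G (sigma j).

(* The rearrangement is only required almost surely: it exists when all the
   U_j lie in (0, 1) and their partial products tend to 0. *)
Definition poisson_dirichlet_process d (T : measurableType d) (R : realType)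
    (P : probability T R) (L : nat -> {RV P >-> R}) : Prop :=
  exists2 U : nat -> {RV P >-> R}, iid_uniform U &
    {ae P, forall w, nonincreasing_rearrangement
                       (stick_breaking (fun j => U j w)) (fun j => L j w)}.

(* Main.v *)
Require Import Defs.
From HB Require Import structures.
From mathcomp Require Import all_boot all_order all_algebra.
From mathcomp Require Import all_classical all_reals all_analysis.
From mathcomp Require Import ring lra zify.

Set Implicit Arguments.
Unset Strict Implicit.
Unset Printing Implicit Defensive.

Import Order.TTheory GRing.Theory Num.Theory.
Import numFieldNormedType.Exports.

Local Open Scope classical_set_scope.
Local Open Scope ring_scope.

(* Following Donnelly and Grimmett, list the prime factors of u in size-biased
   order: pick p_1, p_2, ... without replacement with probability proportional
   to log p. The fraction log p_i / log (x / (p_1 ... p_{i-1})) of what is left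
   plays the role of 1 - U_i. Cut the unit interval into n equal cells. A word
   of m cells has probability n^-m for the stick-breaking process. For the
   primes, the level of distribution replaces the indicator of p_1 ... p_m | u
   by g(p_1) ... g(p_m), and Mertens' estimate for g then shows that the same
   word has probability at least n^-m - o(1), as long as the last cell, where
   p_1 ... p_m could come close to x, is avoided. For a fine grid and large m,
   all but a small proportion of the words decide the event
   {L_1 <= c_1, ..., L_k <= c_k}; lower bounds for the event and for its
   complement have limits adding up to nearly 1, so both are sharp and no upper
   bound sieve is needed. *)

(** * Stick breaking on finite words *)

(** The picks are normalised by log x instead of log u and skip primes already taken, so for a given
    u they have total mass at most 1, not exactly 1. Lost mass is harmless, since only lower bounds
    are sought. The same inequality with a modulus d in the role of u controls the error term: each
    modulus is charged at most once. The last cell is dangerous twice over: the level of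
    distribution only reaches moduli up to x^c with c < 1, and the O(1) in Mertens' estimate is
    negligible only against windows of length comparable to log x. Avoiding that cell keeps log (x /
    (p_1 ... p_m)) above n^-m log x, which answers both. Sorting is replaced by counting: if all m
    listed entries keep away from the thresholds and all unlisted ones lie below them, then the
    number of listed entries above each c_j decides the event, for the sticks and for the primes
    alike. Unlisted entries are only bounded by a small positive residual, so the argument requires
    positive thresholds; a zero threshold is reached at the end by monotonicity. *)

(* Words list the most recent coordinate first. *)
Fixpoint residual (R : realType) (l : seq R) : R :=
  if l is x :: l' then (1 - x) * residual l' else 1.

Fixpoint sticks (R : realType) (l : seq R) : seq R :=
  if l is x :: l' then x * residual l' :: sticks l' else [::].

Definition corner (R : realType) (n : nat) (v : seq nat) : seq R :=
  [seq i%:R / n%:R | i <- v].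

(** The mean of f over the n^m words of length m, with the newest letter averaged first.
    [biased_sum] has the same recursion, so the two can be compared one letter at a time. *)
Fixpoint grid_avg (R : realType) (n m : nat) (f : seq nat -> R) : R :=
  if m is m'.+1 then
    grid_avg n m' (fun v => n%:R^-1 * \sum_(0 <= i < n) f (i :: v))
  else f [::].

(* Every stick of the cell keeps away from the thresholds cs, and the last
   letter n - 1 is avoided, which bounds the residual from below. *)
Fixpoint clear_of (R : realType) (n : nat) (tau : R) (cs : seq R)
    (v : seq nat) : bool :=
  if v is i :: v' then
    [&& (i.+1 < n)%N,
        all (fun c => tau < `|i%:R / n%:R * residual (corner R n v') - c|) cs
      & clear_of n tau cs v']
  else true.

(** The clause [t <= 1] matters for the letter n, which [cells] assigns to a ratio equal to 1. *)
Definition in_cell (R : realType) (n : nat) (i : nat) (t : R) : bool :=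
  (i%:R / n%:R <= t <= i.+1%:R / n%:R) && (t <= 1).

Lemma le_grid_avg (R : realType) n m (f f' : seq nat -> R) :
  (forall v, size v = m -> all (fun i => (i < n)%N) v -> f v <= f' v) ->
  grid_avg n m f <= grid_avg n m f'.
Proof.
elim: m f f' => [|m IH] f f' ff' /=; first exact: ff'.
apply: IH => v sv vn; apply: ler_wpM2l; first by rewrite invr_ge0.
rewrite !big_mkord; apply: ler_sum => i _; apply: ff' => /=.
  by rewrite sv.
by rewrite ltn_ord.
Qed.

Lemma grid_avgD (R : realType) n m (f f' : seq nat -> R) :
  grid_avg n m (fun v => f v + f' v) = grid_avg n m f + grid_avg n m f'.
Proof.
elim: m f f' => [|m IH] f f' //=; rewrite -IH; congr grid_avg.
by apply/funext => v; rewrite big_split mulrDr.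
Qed.

Lemma grid_avgZ (R : realType) n m (a : R) (f : seq nat -> R) :
  grid_avg n m (fun v => a * f v) = a * grid_avg n m f.
Proof.
elim: m f => [|m IH] f //=; rewrite -IH; congr grid_avg.
by apply/funext => v; rewrite -mulr_sumr mulrCA.
Qed.

Lemma grid_avg_sum (R : realType) n m k (f : nat -> seq nat -> R) :
  grid_avg n m (fun v => \sum_(0 <= i < k) f i v)
  = \sum_(0 <= i < k) grid_avg n m (f i).
Proof.
elim: m f => [|m IH] f //=; rewrite -IH; congr grid_avg.
by apply/funext => v; rewrite exchange_big mulr_sumr.
Qed.

Lemma grid_avg_cst (R : realType) n m (a : R) : (0 < n)%N ->
  grid_avg n m (fun=> a) = a.
Proof.
move=> n0; elim: m => [//|m IH] /=; rewrite -[RHS]IH; congr grid_avg.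
apply/funext => v; rewrite sumr_const_nat subn0 -[a *+ n]mulr_natl mulKf//.
by rewrite pnatr_eq0 -lt0n.
Qed.

Lemma size_sticks (R : realType) (l : seq R) : size (sticks l) = size l.
Proof. by elim: l => //= x l ->. Qed.

Lemma sum_nat_interval (R : realType) n (a b : R) : a <= b ->
  \sum_(0 <= i < n) ((a <= i%:R <= b)%R)%:R <= b - a + 1.
Proof.
move=> ab.
(* The second bound carries the induction: when n lies in [a, b], it limits the earlier hits to
   max(0, n - a), and n <= b leaves room for one more. *)
suff [] : \sum_(0 <= i < n) ((a <= i%:R <= b)%R)%:R <= b - a + 1 /\
  \sum_(0 <= i < n) ((a <= i%:R <= b)%R)%:R <= Num.max 0 (n%:R - a) by [].
elim: n => [|n [IH1 IH2]].
  by rewrite big_geq// le_max lexx addr_ge0// subr_ge0.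
rewrite big_nat_recr//=; set S := \sum_(_ <= _ < _) _ in IH1 IH2 *.
rewrite le_max in IH2; rewrite le_max -natr1.
have [/andP[an nb]|_] := boolP (a <= n%:R <= b).
  by split; [|apply/orP; right]; case/orP: IH2 => /=; lra.
by rewrite addr0; split => //; apply/orP; case/orP: IH2 => h; [left|right]; lra.
Qed.

Lemma residual_corner01 (R : realType) n v : (0 < n)%N ->
  all (fun i => (i < n)%N) v -> 0 < residual (corner R n v) <= 1.
Proof.
move=> n0; elim: v => [|i v IH] /=; first by rewrite ltr01 lexx.
move=> /andP[lin /IH /andP[r0 r1]].
have nR : (0 : R) < n%:R by rewrite ltr0n.
have i1 : i%:R / n%:R < 1 :> R by rewrite ltr_pdivrMr// mul1r ltr_nat.
have i0 : 0 <= i%:R / n%:R :> R by rewrite divr_ge0.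
by rewrite mulr_gt0 ?subr_gt0//= mulr_ile1 ?gerBl// ?subr_ge0 ltW.
Qed.

(** The mean of 1 - i/n over the letters is (n + 1)/(2n), which is at most 3/4 once n >= 2, and the
    mean of a product of independent letters factors. *)
Lemma grid_avg_residual (R : realType) n m : (1 < n)%N ->
  grid_avg n m (fun v => residual (corner R n v)) <= (3 / 4) ^+ m.
Proof.
move=> n1; elim: m => [|m IH]; first by rewrite /= expr0.
have nR : (0 : R) < n%:R by rewrite ltr0n ltnW.
have sumE : \sum_(0 <= i < n) (1 - i%:R / n%:R : R) <= n%:R * (3 / 4).
  rewrite sumrB sumr_const_nat subn0 -mulr_suml -natr_sum.
  have -> : (\sum_(0 <= i < n) i)%N = 'C(n, 2).
    by rewrite -(@bin2_sum n).
  have h2 : ('C(n, 2))%:R * 2 = n%:R * (n%:R - 1) :> R.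
    rewrite -[1]/(1%:R) -natrB 1?ltnW// -!natrM muln2.
    by rewrite bin2 halfK oddM -subn1 oddB 1?ltnW//; case: (odd n); rewrite subn0.
  have n2 : (2 : R) <= n%:R by rewrite ler_nat.
  set B := ('C(n, 2))%:R in h2 *.
  have -> : B = n%:R * (n%:R - 1) / 2 by rewrite -h2 mulfK.
  have -> : n%:R * (n%:R - 1) / 2 / n%:R = (n%:R - 1) / 2 :> R.
    by field; rewrite gt_eqF.
  lra.
rewrite exprS.
apply: le_trans (_ : _ <=
  3 / 4 * grid_avg n m (fun v => residual (corner R n v))) _; last first.
  by apply: ler_wpM2l => //; lra.
rewrite -grid_avgZ /=; apply: le_grid_avg => v sv vn /=.
have /andP[r0 _] := residual_corner01 R (ltnW n1) vn.
rewrite -mulr_suml mulrA; apply: ler_wpM2r; first exact: ltW.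
by rewrite ler_pdivrMl.
Qed.


(** Union bound over the m letters. A new letter is n - 1 with frequency 1/n. For a threshold c and
    current residual r, a stick within tau of c requires r >= c0/2, and then i lies in an interval
    of length 2 n tau / r <= 4 n tau / c0. *)
Lemma grid_avg_not_clear (R : realType) n m (tau c0 : R) (cs : seq R) :
  (1 < n)%N -> 0 < tau -> tau <= c0 / 2 -> all (fun c => c0 <= c) cs ->
  grid_avg n m (fun v => (~~ clear_of n tau cs v)%:R)
  <= m%:R * (n%:R^-1 + (size cs)%:R * (4 * tau / c0 + n%:R^-1)).
Proof.
move=> n1 tau0 tauc /allP c0cs.
have nR : (0 : R) < n%:R by rewrite ltr0n ltnW.
set K := n%:R^-1 + _.
elim: m => [|m IH]; first by rewrite /= mul0r.
apply: le_trans (_ : _ <=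
  grid_avg n m (fun v => (~~ clear_of n tau cs v)%:R + K)) _; last first.
  by rewrite grid_avgD grid_avg_cst 1?ltnW// -natr1 mulrDl mul1r lerD2r.
rewrite /=; apply: le_grid_avg => v _ vn /=.
have /andP[r0 r1] := residual_corner01 R (ltnW n1) vn.
set r := residual _ in r0 r1 *; set q := clear_of n tau cs v.
have step i :
  (~~ [&& (i.+1 < n)%N,
          all (fun c => tau < `|i%:R / n%:R * r - c|)%R cs & q])%:R
  <= (~~ q)%:R + (i == n.-1)%:R + (i >= n)%:R
     + \sum_(c <- cs) (`|i%:R / n%:R * r - c| <= tau)%R%:R :> R.
  have S0 : 0 <= \sum_(c <- cs) (`|i%:R / n%:R * r - c| <= tau)%R%:R :> R.
    by apply: sumr_ge0.
  have b0 (b : bool) : 0 <= b%:R :> R by [].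
  have := b0 (i == n.-1); have := b0 (n <= i)%N.
  case: q => /=; last by rewrite !andbF /= !mulr1n; lra.
  rewrite andbT; have [in1/=|ni] := ltnP i.+1 n; last first.
    have : (i == n.-1) || (n <= i)%N by lia.
    by move=> /orP[] -> /=; rewrite ?mulr1n ?mulr0n; lra.
  have [_|] := boolP (all _ cs); first by rewrite /= !mulr0n; lra.
  rewrite -has_predC => /hasP[c ccs /=]; rewrite -leNgt => htau.
  have : 1 <= \sum_(c <- cs) (`|i%:R / n%:R * r - c| <= tau)%R%:R :> R.
    by rewrite (big_rem c)//= htau lerDl sumr_ge0.
  by rewrite /= ?mulr1n ?mulr0n; lra.
apply: le_trans (_ : _ <= n%:R^-1 * \sum_(0 <= i < n)
  ((~~ q)%:R + (i == n.-1)%:R + (i >= n)%:R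
   + \sum_(c <- cs) (`|i%:R / n%:R * r - c| <= tau)%R%:R)) _.
  by apply: ler_wpM2l; [rewrite invr_ge0 ltW | apply: ler_sum => i _; exact: step].
rewrite !big_split /= sumr_const_nat subn0 -[(~~q)%:R *+ n]mulr_natl.
have -> : \sum_(0 <= i < n) (i == n.-1)%:R = 1 :> R.
  rewrite (@big_cat_nat _ _ _ n.-1) ?leq_pred//= big1_seq ?add0r.
    by rewrite -{2}(prednK (ltnW n1)) big_nat1 eqxx.
  by move=> i; rewrite mem_index_iota /=; case: ltngtP.
have -> : \sum_(0 <= i < n) (i >= n)%:R = 0 :> R.
  by rewrite big1_seq// => i; rewrite mem_index_iota /= => /ltn_geF ->.
rewrite addr0 mulrDr mulrDr mulKf ?gt_eqF// -addrA lerD2l mulr1 lerD2l.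
rewrite exchange_big /= mulr_sumr.
have -> : (size cs)%:R * (4 * tau / c0 + n%:R^-1) =
    \sum_(c <- cs) (4 * tau / c0 + n%:R^-1).
  by rewrite big_const_seq count_predT iter_addr_0 mulr_natl.
rewrite big_seq [leRHS]big_seq; apply: ler_sum => c /c0cs c0c.
have c00 : 0 < c0 by lra.
rewrite ler_pdivrMl// mulrDr mulfV ?gt_eqF//.
have [rc|rc] := ltP r (c0 / 2).
  rewrite big1_seq ?addr_ge0 ?mulr_ge0 ?invr_ge0//; try lra.
  move=> i; rewrite mem_index_iota /= => ilen.
  have i1 : i%:R / n%:R <= 1 :> R by rewrite ler_pdivrMr// mul1r ler_nat ltnW.
  have i0 : 0 <= i%:R / n%:R :> R by rewrite divr_ge0 // ltW.
  rewrite leNgt; suff -> : tau < `|i%:R / n%:R * r - c| by [].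
  rewrite distrC; apply: lt_le_trans (ler_norm _).
  have : i%:R / n%:R * r <= r by rewrite ler_piMl// ltW.
  lra.
have eqb (i : nat) : (`|i%:R / n%:R * r - c| <= tau) =
    (n%:R * (c - tau) / r <= i%:R <= n%:R * (c + tau) / r).
  have -> : i%:R / n%:R * r - c = (i%:R * r - n%:R * c) / n%:R.
    by field; rewrite gt_eqF.
  rewrite ler_norml !ler_pdivlMr// !ler_pdivrMr//.
  by congr andb; apply/idP/idP; lra.
under eq_bigr do rewrite eqb.
apply: le_trans (sum_nat_interval n _) _.
  by rewrite ler_pM2r ?invr_gt0// ler_pM2l//; lra.
rewrite lerD2r -mulrBl -mulrBr -mulrA ler_pM2l//.
rewrite ler_pdivrMr// mulrAC ler_pdivlMr//.
have : c0 * tau <= 2 * r * tau by rewrite ler_pM2r//; lra.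
lra.
Qed.

(** [corner] takes left endpoints, hence overestimates the residual. All factors lie in [0, 1], so
    the errors, at most 1/n per letter, merely add up. *)
Lemma residual_in_cell (R : realType) n v (l : seq R) : (0 < n)%N ->
  all2 (in_cell n) v l ->
  0 <= residual l <= 1 /\
  residual l <= residual (corner R n v) <= residual l + (size l)%:R / n%:R.
Proof.
move=> n0; have nR : (0 : R) < n%:R by rewrite ltr0n.
elim: v l => [|i v IH] [|x l]//=; first by rewrite mul0r addr0 lexx ler01.
move=> /andP[/andP[/andP[ix xi] x1] /IH[/andP[r0 r1] /andP[rr rr']]].
set r := residual l in r0 r1 rr rr' *; set r' := residual _ in rr rr' *.
have i0 : 0 <= i%:R / n%:R :> R by rewrite divr_ge0 // ltW.
move: xi; rewrite -[i.+1%:R]natr1 -[(size l).+1%:R]natr1 !mulrDl mul1r => xi.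
set k := _ / n%:R in ix xi i0 *; set h := n%:R^-1 in xi *.
set s := _ / n%:R in rr' *.
have h0 : 0 < h by rewrite invr_gt0.
have s0 : 0 <= s by rewrite divr_ge0// ltW.
split; nra.
Qed.

Lemma sticks_in_cell (R : realType) n v (l : seq R) j : (0 < n)%N ->
  all2 (in_cell n) v l ->
  `|nth 0 (sticks l) j - nth 0 (sticks (corner R n v)) j|
    <= (size l)%:R / n%:R.
Proof.
move=> n0; have nR : (0 : R) < n%:R by rewrite ltr0n.
elim: v l j => [|i v IH] [|x l]//= j.
  by rewrite nth_nil subr0 normr0 mul0r.
move=> /andP[/andP[/andP[ix xi] x1] vl].
have [/andP[r0 r1] /andP[rr rr']] := residual_in_cell n0 vl.
have sS : (size l)%:R / n%:R <= (size l).+1%:R / n%:R :> R.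
  by rewrite ler_pM2r ?invr_gt0// ler_nat.
case: j => [|j] /=; last exact: le_trans (IH _ _ vl) sS.
set r := residual l in r0 r1 rr rr' *; set r' := residual _ in rr rr' *.
have i0 : 0 <= i%:R / n%:R :> R by rewrite divr_ge0 // ltW.
move: xi; rewrite -[i.+1%:R]natr1 -[(size l).+1%:R]natr1 !mulrDl mul1r => xi.
set k := _ / n%:R in ix xi i0 *; set h := n%:R^-1 in xi *.
set s := _ / n%:R in rr' *.
have h0 : 0 < h by rewrite invr_gt0.
have s0 : 0 <= s by rewrite divr_ge0// ltW.
rewrite ler_norml; apply/andP; split; nra.
Qed.

Lemma clear_of_sticks (R : realType) n (tau : R) cs v : clear_of n tau cs v ->
  forall j c, (j < size v)%N -> c \in cs ->
  tau < `|nth 0 (sticks (corner R n v)) j - c|.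
Proof.
elim: v => [|i v IH]//= /and3P[_ /allP h /IH{}IH] [|j] c /=.
  by move=> _ /h.
by move=> jv; exact: IH.
Qed.

Lemma clear_of_letters (R : realType) n (tau : R) cs v : clear_of n tau cs v ->
  all (fun i => (i.+1 < n)%N) v.
Proof. by elim: v => //= i v IH /and3P[-> _ /IH ->]. Qed.

Definition few_large (R : realType) (k : nat) (c : 'I_k -> R) (l : seq R) : bool :=
  [forall j : 'I_k, (count (fun t => (c j < t)%R) l <= j)%N].

(* The j-th largest entry is at most c iff at most j entries exceed c. *)
Lemma ranked_le_few_large (R : realType) (k n : nat) (c : 'I_k -> R)
    (L : nat -> R) (v pos : seq nat) (tau : R) :
  (forall i j : nat, (i <= j)%N -> L j <= L i) ->
  uniq pos -> size pos = size v ->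
  clear_of n tau (codom c) v ->
  (forall i, (i < size v)%N ->
     `|L (nth 0%N pos i) - nth 0 (sticks (corner R n v)) i| <= tau) ->
  (forall q, q \notin pos -> forall j, L q <= c j) ->
  (forall j : 'I_k, L j <= c j) <-> few_large c (sticks (corner R n v)).
Proof.
move=> Lmono upos spos vclear close others.
set t := sticks _ in close *.
have st : size t = size v by rewrite size_sticks size_map.
have countE (j : 'I_k) : count (fun x => c j < x) t = count (fun q => c j < L q) pos.
  rewrite -(mkseq_nth 0 t) -{1}(mkseq_nth 0%N pos) !count_map st spos.
  apply: eq_in_count => i; rewrite mem_iota add0n /= => iv.
  have := clear_of_sticks vclear iv (codom_f c j).
  have := close i iv; rewrite -/t.
  set a := L _; set b := nth 0 t i; rewrite ler_norml ltr_normr => ab bc.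
  by apply/idP/idP; move: ab bc => /andP[a1 a2] /orP[]; lra.
(* The ranks q with L q above c j form an initial segment, by monotonicity, and all of them belong
   to [pos]. *)
have key (j : 'I_k) : (L j <= c j) = (count (fun q => (c j < L q)%R) pos <= j)%N.
  rewrite leNgt; have [cL|Lc] := boolP (c j < L j) => /=.
    apply/esym/negbTE; rewrite -ltnNge.
    rewrite -size_filter -[j.+1](size_iota 0); apply: uniq_leq_size.
      exact: iota_uniq.
    move=> q; rewrite mem_iota add0n ltnS /= => qj.
    have cLq : c j < L q by apply: lt_le_trans cL (Lmono _ _ qj).
    rewrite mem_filter cLq /=; apply: contraLR cLq => /others/(_ j).
    by rewrite -leNgt.
  apply/esym; rewrite -size_filter -[nat_of_ord j in leqRHS](size_iota 0).
  apply: uniq_leq_size; first exact: filter_uniq.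
  move=> q; rewrite mem_filter mem_iota add0n /= => /andP[cLq _].
  rewrite ltnNge; apply: contra Lc => /Lmono jq; exact: lt_le_trans cLq jq.
split => [h|/forallP h j]; first by apply/forallP => j; rewrite countE -key.
by rewrite key -countE.
Qed.

(** * Size-biased sums over prime factors *)

Definition lprod (s : seq nat) : nat := (\prod_(p <- s) p)%N.

Lemma lprod_cons p s : lprod (p :: s) = (p * lprod s)%N.
Proof. by rewrite /lprod big_cons. Qed.

Lemma lprod_gt0 s : all prime s -> (0 < lprod s)%N.
Proof.
elim: s => [|p s IH] /=; first by rewrite /lprod big_nil.
by move=> /andP[/prime_gt0 p0 /IH]; rewrite lprod_cons muln_gt0 p0.
Qed.

Lemma coprime_lprod p s : prime p -> all prime s -> p \notin s ->
  coprime p (lprod s).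
Proof.
move=> pp; elim: s => [|q s IH] /=; first by rewrite /lprod big_nil coprimen1.
move=> /andP[qp sp]; rewrite inE negb_or => /andP[pq ps].
by rewrite lprod_cons coprimeMr IH// andbT prime_coprime// dvdn_prime2.
Qed.

Lemma lprod_dvd s u : uniq s -> all prime s -> all (fun p => p %| u)%N s ->
  (lprod s %| u)%N.
Proof.
elim: s => [|p s IH] /=; first by rewrite /lprod big_nil dvd1n.
move=> /andP[ps us] /andP[pp sp] /andP[pu su].
by rewrite lprod_cons Gauss_dvd ?pu ?IH// coprime_lprod.
Qed.

Lemma ln_lprod (R : realType) s : all prime s ->
  ln (lprod s)%:R = \sum_(p <- s) ln p%:R :> R.
Proof.
elim: s => [|p s IH] /=; first by rewrite /lprod !big_nil ln1.
move=> /andP[pp sp]; rewrite lprod_cons natrM lnM ?IH ?big_cons// posrE ltr0n.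
  exact: prime_gt0.
exact: lprod_gt0.
Qed.

Lemma ler_ln_nat (R : realType) m n : (0 < m)%N -> (m <= n)%N ->
  ln m%:R <= ln n%:R :> R.
Proof.
by move=> m0 mn; rewrite ler_ln ?posrE ?ltr0n ?ler_nat// (leq_trans m0).
Qed.

Lemma sum_ln_prime_divisors (R : realType) N M : (0 < M)%N ->
  \sum_(1 <= p < N | prime p && (p %| M)%N) ln p%:R <= ln M%:R :> R.
Proof.
move=> M0; rewrite -big_filter; set s := seq.filter _ _.
have sp : all prime s.
  by apply/allP => p; rewrite mem_filter => /andP[/andP[]].
rewrite -ln_lprod// ler_ln_nat ?lprod_gt0// dvdn_leq//.
apply: lprod_dvd => //; first by rewrite filter_uniq// iota_uniq.
by apply/allP => p; rewrite mem_filter => /andP[/andP[]].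
Qed.

(* When f s is the indicator of the divisors lprod s of u, this is the
   probability that m size-biased picks without replacement among the prime
   factors of u succeed, except that the weights are normalised by x instead
   of u. The list s records the primes in reverse order of picking. *)
Fixpoint biased_sum (R : realType) (x : R) (m : nat) (f : seq nat -> R) : R :=
  if m is m'.+1 then
    biased_sum x m' (fun s =>
      \sum_(1 <= p < (Num.truncn x).+1 |
             [&& prime p, p \notin s & (p * lprod s)%:R <= x])
        ln p%:R / (ln x - ln (lprod s)%:R) * f (p :: s))
  else f [::].

Definition admissible (R : realType) (x : R) (m : nat) (s : seq nat) : bool :=
  [&& size s == m, uniq s, all prime s & (lprod s)%:R <= x].

Lemma admissible_cons (R : realType) (x : R) m s p : admissible x m s ->
  [&& prime p, p \notin s & (p * lprod s)%:R <= x] ->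
  admissible x m.+1 (p :: s).
Proof.
rewrite /admissible lprod_cons /= eqSS => /and4P[-> -> -> _] /and3P[-> -> ->].
by [].
Qed.

Lemma admissible_ln_ge0 (R : realType) (x : R) m s : admissible x m s ->
  0 <= ln x - ln (lprod s)%:R.
Proof.
move=> /and4P[_ _ sp sx]; have s0 : (0 : R) < (lprod s)%:R.
  by rewrite ltr0n lprod_gt0.
by rewrite subr_ge0 ler_ln// posrE (lt_le_trans s0).
Qed.

Lemma ln_prime_ge0 (R : realType) p : prime p -> 0 <= ln p%:R :> R.
Proof. by move=> /prime_gt0 p0; rewrite ln_ge0// ler1n. Qed.

Lemma le_biased_sum (R : realType) (x : R) m (f f' : seq nat -> R) : 1 <= x ->
  (forall s, admissible x m s -> f s <= f' s) ->
  biased_sum x m f <= biased_sum x m f'.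
Proof.
move=> x1; elim: m f f' => [|m IH] f f' ff' /=.
  by apply: ff'; rewrite /admissible /lprod big_nil.
apply: IH => s sA; apply: ler_sum => p pP; apply: ler_wpM2l; last first.
  by apply: ff'; exact: admissible_cons.
apply: divr_ge0; last exact: admissible_ln_ge0 sA.
by case/and3P: pP => pp _ _; exact: ln_prime_ge0.
Qed.

Lemma biased_sumZ (R : realType) (x : R) m a (f : seq nat -> R) :
  biased_sum x m (fun s => a * f s) = a * biased_sum x m f.
Proof.
elim: m f => [|m IH] f //=; rewrite -IH; congr biased_sum.
by apply/funext => s; rewrite mulr_sumr; apply: eq_bigr => p _; rewrite mulrCA.
Qed.

Lemma biased_sum_sum (R : realType) (x : R) m (r : seq nat) P
    (f : nat -> seq nat -> R) :
  biased_sum x m (fun s => \sum_(i <- r | P i) f i s)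
  = \sum_(i <- r | P i) biased_sum x m (f i).
Proof.
elim: m f => [|m IH] f //=; rewrite -IH; congr biased_sum.
apply/funext => s; rewrite exchange_big; apply: eq_bigr => p _ /=.
by rewrite mulr_sumr.
Qed.

Lemma biased_sumB (R : realType) (x : R) m (f f' : seq nat -> R) :
  biased_sum x m (fun s => f s - f' s) = biased_sum x m f - biased_sum x m f'.
Proof.
elim: m f f' => [|m IH] f f' //=; rewrite -IH; congr biased_sum.
by apply/funext => s; rewrite -sumrB; apply: eq_bigr => p _; rewrite mulrBr.
Qed.

(** If u = M * lprod s, the next prime divides M, and the distinct primes dividing M have logarithms
    summing to at most ln M <= ln x - ln (lprod s). So every further pick has total weight at most
    1. *)
Lemma biased_sum_dvd (R : realType) (x : R) m u : (0 < u)%N -> u%:R <= x ->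
  biased_sum x m (fun s => (lprod s %| u)%:R) <= 1.
Proof.
move=> u0 ux; have x1 : 1 <= x by rewrite (le_trans _ ux)// ler1n.
elim: m => [|m IH]; first by rewrite /= /lprod big_nil dvd1n.
apply: le_trans IH => /=; apply: le_biased_sum => // s sA.
have D0 := admissible_ln_ge0 sA; set D := _ - _ in D0 *.
have sp : all prime s by case/and4P: sA.
have s0 := lprod_gt0 sp.
have [/dvdnP[M uE]|su] := boolP (lprod s %| u)%N; last first.
  rewrite big1// => p _; rewrite lprod_cons.
  case: (boolP (_ %| u)%N) => [|_]; last by rewrite mulr0.
  by move=> /(dvdn_trans (dvdn_mull p (dvdnn _))); rewrite (negbTE su).
have M0 : (0 < M)%N by move: u0; rewrite uE muln_gt0 => /andP[].
apply: le_trans (_ : _ <= \sum_(1 <= p < (Num.truncn x).+1 |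
                             prime p && (p %| M)%N) ln p%:R / D) _.
  rewrite big_mkcond [leRHS]big_mkcond /=; apply: ler_sum => p _.
  rewrite lprod_cons uE dvdn_pmul2r//.
  have [pp/=|//] := boolP (prime p).
  have w0 : 0 <= ln p%:R / D by rewrite divr_ge0// ln_prime_ge0.
  by case: (p %| M)%N; case: ifP => _ //=; rewrite ?mulr1 ?mulr0.
rewrite -mulr_suml.
have lnM : ln M%:R <= D.
  rewrite /D lerBrDr -lnM ?posrE ?ltr0n// -natrM -uE ler_ln// posrE ?ltr0n//.
  by rewrite (lt_le_trans _ x1).
have := le_trans (sum_ln_prime_divisors R (Num.truncn x).+1 M0) lnM.
(* If lprod s already equals x then D = 0, and the convention 1/0 = 0 makes the weights vanish. *)
move: D0; rewrite le_eqVlt => /orP[/eqP <-|D0]; first by rewrite invr0 mulr0.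
by rewrite ler_pdivrMr// mul1r.
Qed.

(** * Mertens' estimate for g on logarithmic windows *)

Definition mertens_bound (R : realType) (g : nat -> R) (K : R) : Prop :=
  forall t : R, 1 <= t ->
    `|\sum_(1 <= p < (Num.truncn t).+1 | prime p) g p * ln p%:R - ln t| <= K.

(** The term is the difference of the partial sums at p and p - 1, and ln p - ln (p - 1) <= ln 2 <=
    1. *)
Lemma mertens_term (R : realType) (g : nat -> R) (K : R) p :
  mertens_bound g K -> prime p -> g p * ln p%:R <= 1 + 2 * K.
Proof.
move=> HK pp; have p1 := prime_gt1 pp.
have := HK p%:R; rewrite ler1n prime_gt0// natrK => /(_ isT).
have := HK p.-1%:R; rewrite ler1n -ltnS prednK ?prime_gt0// p1 natrK => /(_ isT).
rewrite prednK ?prime_gt0//.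
have -> : \sum_(1 <= q < p.+1 | prime q) g q * ln q%:R =
    \sum_(1 <= q < p | prime q) g q * ln q%:R + g p * ln p%:R.
  by rewrite big_mkcond big_nat_recr ?prime_gt0//= pp -big_mkcond.
have lnp : ln p%:R <= 1 + ln p.-1%:R :> R.
  have p0 : (0 : R) < p.-1%:R by rewrite ltr0n -ltnS prednK ?prime_gt0.
  apply: le_trans (_ : _ <= ln ((1 + 1) * p.-1%:R)) _.
    rewrite ler_ln ?posrE ?ltr0n ?prime_gt0 ?mulr_gt0//.
    by rewrite -[1 + 1]/(2%:R) -natrM ler_nat; lia.
  by rewrite lnM ?posrE// lerD2r le_ln1Dx//; lra.
set S := \sum_(_ <= _ < _ | _) _; set F := g p * _.
rewrite !ler_norml => /andP[h1 h2] /andP[h3 h4]; lra.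
Qed.

Lemma sum_truncn_widen (R : realType) (t x : R) (F : nat -> R) P :
  0 <= t -> t <= x ->
  \sum_(1 <= p < (Num.truncn t).+1 | P p) F p =
  \sum_(1 <= p < (Num.truncn x).+1 | P p) F p * (p%:R <= t)%R%:R.
Proof.
move=> t0 tx; rewrite (@big_nat_widen _ _ _ _ _ (Num.truncn x).+1); last first.
  by rewrite ltnS le_truncn.
rewrite big_mkcondr /=; apply: eq_bigr => p _.
by rewrite ltnS truncn_ge_nat//; case: ifP; rewrite ?mulr1 ?mulr0.
Qed.

(* The successor in (size s).+1 pays for a prime equal to expR b. *)
Lemma mertens_window (R : realType) (g : nat -> R) (K x a b : R) (s : seq nat) :
  mertens_bound g K -> (forall p, prime p -> 0 <= g p) ->
  0 <= a -> a <= b -> expR b <= x ->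
  b - a - 2 * K - (size s).+1%:R * (1 + 2 * K) <=
  \sum_(1 <= p < (Num.truncn x).+1 | [&& prime p, p \notin s & a <= ln p%:R < b])
     g p * ln p%:R.
Proof.
move=> HK g0 a0 ab bx.
have ea : 1 <= expR a by rewrite -[leLHS]expR0 ler_expR.
have eab : expR a <= expR b by rewrite ler_expR.
have := HK _ ea; have := HK _ (le_trans ea eab).
rewrite !expRK (sum_truncn_widen _ _ _ bx); last exact: ltW (expR_gt0 _).
rewrite (sum_truncn_widen _ _ _ (le_trans eab bx)); last exact: ltW (expR_gt0 _).
set Sb := \sum_(_ <= _ < _ | _) _; set Sa := \sum_(_ <= _ < _ | _) _.
set W := \sum_(_ <= _ < _ | _) _.
set X := (Num.truncn x).+1 in Sb Sa W *.
set s' := Num.truncn (expR b) :: s.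
have K0 : 0 <= K by apply: le_trans (HK 1 (lexx _)).
(* Each prime lost to s or to the endpoint costs at most 1 + 2 K, by [mertens_term]. *)
suff : Sb <= Sa + (size s)%:R * (1 + 2 * K) + (1 + 2 * K) + W.
  by rewrite -natr1 !ler_norml => h /andP[h1 h2] /andP[h3 h4]; lra.
set M := 1 + 2 * K; have M0 : 0 <= M by rewrite /M; lra.
have sumM : \sum_(1 <= p < X) \sum_(q <- s') M * (p == q)%:R <= (size s)%:R * M + M.
  rewrite exchange_big /=; apply: le_trans (_ : _ <= \sum_(q <- s') M) _.
    apply: ler_sum => q _; rewrite -mulr_sumr ler_piMr//.
    rewrite -natr_sum lern1 -big_mkcond /= sum1_count.
    by rewrite (@count_uniq_mem _ _ q) ?iota_uniq// leq_b1.
  by rewrite big_const_seq count_predT iter_addr_0 /= mulrS addrC mulr_natl.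
suff : Sb <= \sum_(1 <= p < X) \sum_(q <- s') M * (p == q)%:R + (Sa + W) by lra.
rewrite /Sa /Sb /W big_mkcond [X in _ + (X + _)]big_mkcond.
rewrite [X in _ + (_ + X)]big_mkcond /=.
rewrite -!big_split /=; apply: ler_sum => p _.
have T0 : 0 <= \sum_(q <- s') M * (p == q)%:R by apply: sumr_ge0 => q _; rewrite mulr_ge0.
have [pp/=|_] := boolP (prime p); last by rewrite !addr0.
have F0 : 0 <= g p * ln p%:R by rewrite mulr_ge0 ?g0 ?ln_prime_ge0.
have FM : g p * ln p%:R <= M by apply: mertens_term.
set F := g p * _ in F0 FM *.
have Fb (c : bool) : 0 <= F * c%:R by rewrite mulr_ge0.
have [pb|pb] := boolP (p%:R <= expR b); last first.
  by rewrite mulr0 !addr_ge0//; case: ifP.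
rewrite mulr1; have [ps'|] := boolP (p \in s').
  have : M <= \sum_(q <- s') M * (p == q)%:R.
    by rewrite (big_rem p)//= eqxx mulr1 lerDl sumr_ge0// => q _; rewrite mulr_ge0.
  have := Fb (p%:R <= expR a); case: ifP => _; lra.
rewrite inE negb_or => /andP[pb' ps]; rewrite ps /=.
have p0 : (0 : R) < p%:R by rewrite ltr0n prime_gt0.
have [pa|pa] := boolP (p%:R <= expR a).
  by rewrite mulr1; case: ifP; lra.
have -> : (a <= ln p%:R < b) = true; last by rewrite mulr0; lra.
apply/andP; split.
  by rewrite -(expRK a) ler_ln ?posrE ?expR_gt0//; move: pa; rewrite -ltNge => /ltW.
rewrite -(expRK b) ltr_ln ?posrE ?expR_gt0// lt_neqAle pb andbT.
by apply: contra pb' => /eqP <-; rewrite natrK.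
Qed.

(** * Cells of a list of primes and the lower bound for their weights *)

Fixpoint ratios (R : realType) (x : R) (s : seq nat) : seq R :=
  if s is p :: s' then
    ln p%:R / (ln x - ln (lprod s')%:R) :: ratios x s'
  else [::].

Definition cells (R : realType) (n : nat) (x : R) (s : seq nat) : seq nat :=
  [seq Num.truncn (n%:R * t) | t <- ratios x s].

Lemma size_ratios (R : realType) (x : R) s : size (ratios x s) = size s.
Proof. by elim: s => //= p s ->. Qed.

Lemma cells_cons (R : realType) n (x : R) p s :
  cells n x (p :: s) =
  Num.truncn (n%:R * (ln p%:R / (ln x - ln (lprod s)%:R))) :: cells n x s.
Proof. by []. Qed.

Lemma admissible_behead (R : realType) (x : R) m p s :
  admissible x m.+1 (p :: s) ->
  [/\ prime p, admissible x m s, (p * lprod s)%:R <= x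
    & 0 < ln x - ln (lprod s)%:R].
Proof.
rewrite /admissible lprod_cons /= eqSS.
move=> /and4P[-> /andP[_ ->] /andP[pp sp] psx]; rewrite sp /=.
have s0 := lprod_gt0 sp.
have lts : (lprod s)%:R < x.
  by apply: lt_le_trans psx; rewrite ltr_nat ltn_Pmull// prime_gt1.
split=> //; first exact: ltW.
by rewrite subr_gt0 ltr_ln ?posrE ?ltr0n// (lt_trans _ lts)// ltr0n.
Qed.

(** The denominators telescope: the part left after picking s is ln (x / lprod s) as a fraction of
    ln x, so multiplying a ratio by it restores the common denominator ln x. *)
Lemma ratios_admissible (R : realType) (x : R) m s : 1 < x ->
  admissible x m s ->
  [/\ ln x - ln (lprod s)%:R = ln x * residual (ratios x s),
      sticks (ratios x s) = [seq ln p%:R / ln x | p <- s]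
    & all (fun t => 0 <= t <= 1) (ratios x s)].
Proof.
move=> x1; have lx : 0 < ln x by rewrite ln_gt0.
elim: s m => [|p s IH] m; first by rewrite /lprod big_nil ln1 subr0 mulr1.
case: m => [/and4P[]//|m] /admissible_behead[pp sA psx D0].
have sp : all prime s by case/and4P: sA.
have [E1 E2 E3] := IH _ sA; rewrite /= E2 E3 lprod_cons andbT.
have x0 : 0 < x by rewrite (lt_trans _ x1).
have lnE : ln (p * lprod s)%:R = ln p%:R + ln (lprod s)%:R :> R.
  by rewrite natrM lnM// posrE ltr0n; [exact: prime_gt0 | exact: lprod_gt0].
have lnpD : ln (p * lprod s)%:R <= ln x.
  by rewrite ler_ln ?posrE// ltr0n muln_gt0 prime_gt0// lprod_gt0.
rewrite lnE in lnpD *.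
have res : residual (ratios x s) = (ln x - ln (lprod s)%:R) / ln x.
  by rewrite E1 mulrAC mulfV ?gt_eqF// mul1r.
split.
- by rewrite res; field; rewrite !gt_eqF.
- by congr cons; rewrite res; field; rewrite !gt_eqF.
- apply/andP; split; first by rewrite divr_ge0 ?ln_prime_ge0 ?ltW.
  by rewrite ler_pdivrMr// mul1r lerBrDr.
Qed.

Lemma cells_in_cell (R : realType) n (x : R) m s : (0 < n)%N -> 1 < x ->
  admissible x m s -> all2 (in_cell n) (cells n x s) (ratios x s).
Proof.
move=> n0 x1 /(ratios_admissible x1)[_ _]; rewrite /cells.
elim: (ratios x s) => //= t l IH /andP[/andP[t0 t1] /IH ->].
rewrite /in_cell t1 !andbT.
have nR : (0 : R) < n%:R by rewrite ltr0n.
have /truncn_itv/andP[h1 h2] : 0 <= n%:R * t by rewrite mulr_ge0// ltW.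
by rewrite ler_pdivrMr// ler_pdivlMr// ![t * _]mulrC h1 ltW.
Qed.

(** Without the letter n - 1, every factor 1 - t is at least 1/n. For primes this keeps lprod s
    below x^(1 - n^-m) and the next windows long. *)
Lemma residual_ge (R : realType) n v (l : seq R) : (0 < n)%N ->
  all2 (in_cell n) v l -> all (fun i => (i.+1 < n)%N) v ->
  n%:R^-1 ^+ size l <= residual l.
Proof.
move=> n0; have nR : (0 : R) < n%:R by rewrite ltr0n.
elim: v l => [|i v IH] [|t l]//= /andP[/andP[/andP[_ ti] _] vl] /andP[iln vn].
rewrite exprS; apply: ler_pM;
  [by rewrite invr_ge0 ltW | by rewrite exprn_ge0// invr_ge0 ltW | | exact: IH].
have : i.+1%:R / n%:R <= 1 - n%:R^-1 :> R.
  rewrite ler_pdivrMr// mulrBl mul1r mulVf ?gt_eqF// lerBrDr natr1 ler_nat.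
  exact: iln.
lra.
Qed.

Lemma sum_pick_le (R : realType) n c (F : nat -> R) : 0 <= F c ->
  \sum_(0 <= i < n) F i * (c == i)%:R <= F c.
Proof.
move=> Fc0.
have -> : \sum_(0 <= i < n) F i * (c == i)%:R = F c * \sum_(0 <= i < n) (i == c)%:R.
  rewrite mulr_sumr; apply: eq_bigr => i _; rewrite eq_sym.
  by have [->|] := eqVneq i c; rewrite ?mulr0.
rewrite ler_piMr// -natr_sum lern1 -big_mkcond /= sum1_count.
by rewrite (@count_uniq_mem _ _ c) ?iota_uniq// leq_b1.
Qed.

(** Induction on the number of picks, with the newest letter averaged into [B']. Given s and D = ln
    x - ln (lprod s), letter i means that ln p lies in [i D/n, (i+1) D/n). By [mertens_window] these
    primes carry g(p) ln p / D of total at least 1/n - E/D, and D >= n^-m ln x turns this into the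
    factor (1 - K'/ln x)/n. A new prime is coprime to lprod s, so g splits. *)
Lemma biased_sum_ge (R : realType) (g : nat -> R) (K : R) n m0 (x : R) :
  mertens_bound g K -> Defs.multiplicative g ->
  (forall d, (0 < d)%N -> 0 <= g d) -> (1 < n)%N -> 1 < x ->
  let K' := n%:R ^+ m0 * (2 * K + m0%:R * (1 + 2 * K)) in
  K' <= ln x ->
  forall m (B : seq nat -> R), (m <= m0)%N -> (forall v, 0 <= B v) ->
  (forall v, B v != 0 -> all (fun i => (i.+1 < n)%N) v) ->
  (1 - K' / ln x) ^+ m * grid_avg n m B <=
  biased_sum x m (fun s => B (cells n x s) * g (lprod s)).
Proof.
move=> HK [g1 gM] g0 n1 x1 K' K'x.
have lx : 0 < ln x by rewrite ln_gt0.
have nR : (0 : R) < n%:R by rewrite ltr0n ltnW.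
have K0 : 0 <= K by apply: le_trans (HK 1 (lexx _)).
set q := 1 - _; have q0 : 0 <= q by rewrite /q subr_ge0 ler_pdivrMr// mul1r.
elim=> [|m IH] B mm0 B0 Bn.
  by rewrite expr0 mul1r /= /lprod big_nil g1 mulr1.
pose B' v := n%:R^-1 * \sum_(0 <= i < n) B (i :: v).
have B'0 v : 0 <= B' v by rewrite mulr_ge0 ?invr_ge0// sumr_ge0.
have B'n v : B' v != 0 -> all (fun i => (i.+1 < n)%N) v.
  apply: contraR => nv; rewrite /B' big1 ?mulr0// => i _.
  by apply/eqP; apply: contraNT nv => /Bn /= /andP[].
rewrite exprS -mulrA.
apply: le_trans (ler_wpM2l q0 (IH B' (ltnW mm0) B'0 B'n)) _.
rewrite -biased_sumZ /=; apply: le_biased_sum => [|s sA]; first exact: ltW.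
have [sz us sp _] := and4P sA.
have D0 := admissible_ln_ge0 sA.
have [DE _ _] := ratios_admissible x1 sA.
have := cells_in_cell (ltnW n1) x1 sA; set v := cells n x s => vl.
set D := ln x - _ in D0 DE *.
have gs0 : 0 <= g (lprod s) by rewrite g0// lprod_gt0.
have [vn|/negP nv] := boolP (all (fun i => (i.+1 < n)%N) v); last first.
  have -> : B' v = 0 by apply/eqP; apply: contra_notT nv; exact: B'n.
  rewrite mul0r mulr0; apply: sumr_ge0 => p /and3P[pp _ _].
  rewrite !mulr_ge0 ?invr_ge0 ?ln_prime_ge0// g0// lprod_cons muln_gt0.
  by rewrite prime_gt0// lprod_gt0.
have Dlb : ln x * n%:R^-1 ^+ m <= D.
  rewrite DE ler_pM2l//; have := residual_ge (ltnW n1) vl vn.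
  by rewrite size_ratios (eqP sz).
have Dp : 0 < D by apply: lt_le_trans Dlb; rewrite mulr_gt0// exprn_gt0// invr_gt0.
pose win i p : bool := i%:R * D / n%:R <= ln p%:R < i.+1%:R * D / n%:R.
have winE i p : prime p -> win i p = (Num.truncn (n%:R * (ln p%:R / D)) == i).
  move=> pp; rewrite truncn_eq; last by rewrite !mulr_ge0 ?invr_ge0 ?ln_prime_ge0// ltW.
  rewrite /win mulrA ler_pdivlMr// ltr_pdivrMr// ler_pdivrMr// ltr_pdivlMr//.
  by rewrite ![_ * n%:R]mulrC.
pose cond p := [&& prime p, p \notin s & (p * lprod s)%:R <= x].
pose X := (Num.truncn x).+1.
apply: le_trans (_ : _ <= \sum_(1 <= p < X | cond p)
   \sum_(0 <= i < n) B (i :: v) * g (lprod s) / D *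
                          (g p * ln p%:R * (win i p)%:R)) _; last first.
  apply: ler_sum => p /and3P[pp ps psx].
  rewrite lprod_cons gM ?(prime_gt0 pp) ?(lprod_gt0 sp) ?coprime_lprod//=.
  rewrite cells_cons -/v -/D.
  set c := Num.truncn _.
  under eq_bigr do rewrite winE// mulrA -/c.
  (* Only an inequality: a ratio equal to 1 has letter n and falls in none of the n windows. *)
  apply: le_trans (sum_pick_le _ _) _.
    rewrite !mulr_ge0 ?invr_ge0//; [|exact: ln_prime_ge0]; apply: g0; exact: prime_gt0.
  by rewrite le_eqVlt; apply/orP; left; apply/eqP; ring.
rewrite exchange_big /=.
have -> : q * (B' v * g (lprod s)) =
    \sum_(0 <= i < n) q * n%:R^-1 * (B (i :: v) * g (lprod s)).
  by rewrite /B' -mulr_sumr -mulr_suml; ring.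
apply: ler_sum => i _; rewrite -mulr_sumr.
have [->|Bi] := eqVneq (B (i :: v)) 0; first by rewrite !mul0r !mulr0.
have /andP[iln _] := Bn _ Bi.
rewrite mulrC -[leRHS]mulrA ler_wpM2l ?mulr_ge0// ler_pdivlMl//.
pose E := 2 * K + m.+1%:R * (1 + 2 * K).
have E0 : 0 <= E by rewrite /E; have : 0 <= m.+1%:R :> R by []; nra.
have -> : D * (q * n%:R^-1) = D / n%:R - K' / ln x * D / n%:R.
  by rewrite /q; ring.
(* Here the shape of K' is used: D/n >= ln x / n^(m+1), and n^m0 with m + 1 <= m0 absorbs that power
   of n. *)
have KE : E <= K' / ln x * D / n%:R.
  apply: le_trans (_ : _ <= K' / ln x * (ln x * n%:R^-1 ^+ m) / n%:R) _; last first.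
    rewrite ler_pM2r ?invr_gt0// ler_wpM2l// divr_ge0 ?(ltW lx)//.
    by rewrite /K' mulr_ge0 ?exprn_ge0// addr_ge0 ?mulr_ge0 ?addr_ge0 ?mulr_ge0.
  rewrite mulrA divfK ?gt_eqF// -mulrA -exprSr exprVn ler_pdivlMr ?exprn_gt0//.
  rewrite mulrC /K'; apply: ler_pM => //.
    by rewrite ler_weXn2l// ler1n ltnW.
  by rewrite /E lerD2l ler_wpM2r ?ler_nat//; lra.
have := @mertens_window _ g K x (i%:R * D / n%:R) (i.+1%:R * D / n%:R) s HK.
have D_le b : b <= D -> expR b <= x.
  move=> bD; rewrite -[x in leRHS]lnK ?posrE ?(lt_trans _ x1)// ler_expR.
  apply: le_trans bD _; rewrite /D gerBl ln_ge0// ler1n lprod_gt0//.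
have in1D : i.+1%:R * D / n%:R <= D.
  by rewrite ler_pdivrMr// mulrC ler_wpM2l// ler_nat ltnW.
move=> /(_ (fun p pp => g0 p (prime_gt0 pp))) => wind.
apply: le_trans (le_trans _ (wind _ _ (D_le _ in1D))) _.
- rewrite (eqP sz) /E in KE *.
  have -> : i.+1%:R * D / n%:R - i%:R * D / n%:R = D / n%:R.
    by rewrite -natr1; ring.
  by lra.
- by rewrite !mulr_ge0// invr_ge0.
- by rewrite ler_pM2r ?invr_gt0// ler_wpM2r// ler_nat.
rewrite big_mkcond [leRHS]big_mkcond /=; apply: ler_sum => p _.
rewrite /cond /win; have [pp/=|//] := boolP (prime p).
have w0 : 0 <= g p * ln p%:R by rewrite mulr_ge0 ?ln_prime_ge0 ?g0 ?prime_gt0.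
have [ps/=|_] := boolP (p \notin s); last by [].
have [/andP[_ lt2]|_] := boolP (_ <= ln p%:R < _); last first.
  by case: ifP; rewrite ?mulr0.
(* The size condition on p is automatic inside the window, whose right end (i+1) D/n is at most
   D. *)
suff -> : (p * lprod s)%:R <= x by rewrite mulr1.
rewrite natrM -ler_pdivlMr ?ltr0n ?lprod_gt0//.
have x0 : 0 < x by rewrite (lt_trans _ x1).
rewrite -ler_ln ?posrE ?divr_gt0 ?ltr0n ?lprod_gt0 ?prime_gt0//.
rewrite ln_div ?posrE ?ltr0n ?lprod_gt0//.
exact: le_trans (ltW lt2) in1D.
Qed.

(** * Transfer to the random integer u *)

Lemma near_ln_ge (R : realType) (M : R) : \forall x \near +oo, M <= ln x.
Proof.
have := nbhs_pinfty_ge (num_real (expR M)); apply: filterS => x xM.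
by rewrite -(expRK M) ler_ln ?posrE ?expR_gt0// (lt_le_trans (expR_gt0 M)).
Qed.

(** The Landau bound holds beyond some x0. Up to x1 > x0, monotonicity bounds the sum by its value
    at x1 and the logarithm by ln x1, which explains the constant. *)
Lemma mertens_bound_bigO (R : realType) (g : nat -> R) :
  (forall p, prime p -> 0 <= g p) ->
  (fun x : R =>
     \sum_(1 <= p < (Num.truncn x).+1 | prime p) g p * ln p%:R - ln x)
     =O_ (pinfty_nbhs R) (fun=> 1 : R) ->
  exists K, mertens_bound g K.
Proof.
move=> g0 /eqO_exP[k k0 /= [x0 [_ Hx0]]].
pose S (t : R) := \sum_(1 <= p < (Num.truncn t).+1 | prime p) g p * ln p%:R.
pose x1 := Num.max x0 1 + 1.
have S0 t : 0 <= S t.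
  by apply: sumr_ge0 => p pp; rewrite mulr_ge0 ?g0 ?ln_prime_ge0.
have x1x0 : x0 < x1 by rewrite /x1 ltr_pwDr// le_max lexx.
have x11 : 1 <= x1 by rewrite /x1 ler_wpDr// le_max lexx orbT.
exists (k + S x1 + ln x1) => t t1; rewrite -/(S t).
have lnx1 : 0 <= ln x1 by rewrite ln_ge0.
have [tx1|x1t] := leP t x1; last first.
  by have := Hx0 t (lt_trans x1x0 x1t); rewrite normr1 mulr1 -/(S t); have := S0 x1; lra.
have lnt : 0 <= ln t <= ln x1.
  by rewrite ln_ge0// ler_ln ?posrE ?(lt_le_trans ltr01)//.
have St : S t <= S x1.
  rewrite /S (sum_truncn_widen _ _ _ tx1); last exact: le_trans t1.
  apply: ler_sum => p pp; rewrite ler_piMr// ?lern1 ?leq_b1//.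
  by rewrite mulr_ge0 ?g0 ?ln_prime_ge0.
have := S0 t; move: lnt => /andP[l0 l1]; rewrite ler_norml => ?; apply/andP; split; lra.
Qed.

Lemma seqN_near_gt0 (R : realType) (a : nat -> R) :
  (forall n : nat, (0 < n)%N -> 0 <= a n) ->
  (exists2 n : nat, (0 < n)%N & 0 < a n) ->
  \forall x \near +oo, 0 < seqN a x.
Proof.
move=> a0 [n n0 an]; have := nbhs_pinfty_ge (num_real (n%:R : R)).
apply: filterS => x nx; rewrite /seqN big_nat_cond.
have x0 : 0 <= x by apply: le_trans nx.
have nX : n \in index_iota 1 (Num.truncn x).+1.
  by rewrite mem_index_iota n0 ltnS truncn_ge_nat.
rewrite (big_rem n)//= n0 ltnS truncn_ge_nat// nx /=.
by rewrite ltr_pwDl// sumr_ge0// => i /andP[/andP[/a0]].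
Qed.

Lemma le_seqN (R : realType) (a : nat -> R) (y x : R) :
  0 <= y -> y <= x ->
  seqN a y = \sum_(1 <= u < (Num.truncn x).+1) a u * (u%:R <= y)%R%:R.
Proof. by move=> y0 yx; rewrite /seqN (sum_truncn_widen _ _ y0 yx). Qed.

Lemma bernoulli_ineq (R : realType) (t : R) m : 0 <= t <= 1 ->
  1 - m%:R * t <= (1 - t) ^+ m.
Proof.
move=> /andP[t0 t1]; elim: m => [|m IH]; first by rewrite mul0r subr0.
rewrite exprSr; have : (1 - m%:R * t) * (1 - t) <= (1 - t) ^+ m * (1 - t).
  by rewrite ler_wpM2r// subr_ge0.
have m0 : 0 <= m%:R :> R by [].
by rewrite -natr1; nra.
Qed.

Lemma biased_sum0 (R : realType) (x : R) m : biased_sum x m (fun=> 0) = 0.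
Proof.
rewrite -[RHS](mul0r (biased_sum x m (fun=> 0))) -biased_sumZ.
by congr biased_sum; apply/funext => s; rewrite mul0r.
Qed.

Lemma sum_pmf_biased_sum (R : realType) (a : nat -> R) (x : R) m
    (f : seq nat -> R) :
  \sum_(1 <= u < (Num.truncn x).+1)
     pmf_u a x u * biased_sum x m (fun s => f s * (lprod s %| u)%:R) =
  biased_sum x m (fun s => f s * (seqNd a (lprod s) x / seqN a x)).
Proof.
under eq_bigr do rewrite -biased_sumZ.
rewrite -biased_sum_sum; congr biased_sum; apply/funext => s.
rewrite /seqNd [in RHS]big_mkcond mulr_suml mulr_sumr; apply: eq_bigr => u _.
by rewrite /pmf_u; case: (_ %| _)%N; rewrite /= ?mulr1 ?mulr0 ?mul0r ?mulr0// mulrC.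
Qed.

(** Many lists s share one product. Bound r (lprod s) by the sum of r d over all d <= D divisible by
    lprod s, of which d = lprod s is one term, and exchange the sums: for fixed d the lists with
    lprod s dividing d have total weight at most 1, by [biased_sum_dvd] with u := d. *)
Lemma biased_sum_error (R : realType) (x D : R) m (f : seq nat -> R)
    (r : nat -> R) :
  1 <= x -> 0 <= D -> D <= x -> (forall d, 0 <= r d) ->
  (forall s, admissible x m s -> 0 <= f s <= 1) ->
  (forall s, admissible x m s -> f s != 0 -> (lprod s)%:R <= D) ->
  biased_sum x m (fun s => f s * r (lprod s)) <=
  \sum_(1 <= d < (Num.truncn D).+1) r d.
Proof.
move=> x1 D0 Dx r0 f01 fD.
apply: le_trans (_ : _ <= biased_sum x m (fun s =>
  \sum_(1 <= d < (Num.truncn D).+1) r d * (lprod s %| d)%:R)) _.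
  apply: le_biased_sum => // s sA.
  have [->|fs] := eqVneq (f s) 0.
    by rewrite mul0r sumr_ge0// => d _; rewrite mulr_ge0.
  have sD := fD s sA fs.
  have s0 : (0 < lprod s)%N by rewrite lprod_gt0//; case/and4P: sA.
  have sI : lprod s \in index_iota 1 (Num.truncn D).+1.
    by rewrite mem_index_iota s0 ltnS truncn_ge_nat.
  rewrite (big_rem _ sI) /= dvdnn mulr1; have /andP[f0 f1] := f01 s sA.
  have := ler_piMl (r0 (lprod s)) f1.
  suff : 0 <= \sum_(y <- rem (lprod s) (index_iota 1 (Num.truncn D).+1))
    r y * (lprod s %| y)%:R by lra.
  by apply: sumr_ge0 => d _; rewrite mulr_ge0.
rewrite biased_sum_sum big_nat [leRHS]big_nat; apply: ler_sum => d /andP[d0 dD].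
rewrite biased_sumZ ler_piMr// biased_sum_dvd//.
by rewrite (le_trans _ Dx)// -truncn_ge_nat.
Qed.

(** Three losses of eta/3: the u below x^(1 - eps), by regularity; the replacement of N_d/N by g(d),
    by the level of distribution; and the factor (1 - K'/ln x)^m, by Bernoulli's inequality. *)
Lemma prob_u_liminf (R : realType) (a : nat -> R) n m (B : seq nat -> R)
    (E : set nat) (eps eta : R) :
  (forall n : nat, (0 < n)%N -> 0 <= a n) ->
  (exists2 n : nat, (0 < n)%N & 0 < a n) ->
  regular_seq a -> has_level_of_distribution a 1 ->
  (1 < n)%N -> (0 < m)%N -> 0 < eps -> 0 < eta ->
  (forall v, 0 <= B v <= 1) ->
  (forall v, B v != 0 -> all (fun i => (i.+1 < n)%N) v) ->
  (forall x u s, 1 < x -> (0 < u)%N -> x `^ (1 - eps) <= u%:R -> u%:R <= x ->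
     admissible x m s -> (lprod s %| u)%N -> B (cells n x s) != 0 -> E u) ->
  \forall x \near +oo, grid_avg n m B - eta <= prob_u a x E.
Proof.
move=> a0 a_pos a_reg [g [gM g01 gmert _ glevel]] n1 m0 eps0 eta0 B01 Bn BE.
have [K HK] := mertens_bound_bigO (fun p pp => proj1 (andP (g01 p (prime_gt0 pp)))) gmert.
have g0 d : (0 < d)%N -> 0 <= g d by move=> /g01 /andP[].
have B0 v : 0 <= B v by case/andP: (B01 v).
have nR : (0 : R) < n%:R by rewrite ltr0n ltnW.
pose K' := n%:R ^+ m * (2 * K + m%:R * (1 + 2 * K)).
have K0 : 0 <= K by apply: le_trans (HK 1 (lexx _)).
have K'0 : 0 <= K'.
  by rewrite /K' mulr_ge0 ?exprn_ge0// addr_ge0 ?mulr_ge0 ?addr_ge0 ?mulr_ge0.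
(* By [residual_ge], every modulus lprod s met by B is at most x^c. *)
pose c : R := 1 - n%:R^-1 ^+ m.
have c0 : 0 < c.
  by rewrite subr_gt0 exprn_ilt1 ?invr_ge0//; [rewrite -lt0n | rewrite invf_lt1// ltr1n].
have c1 : c < 1 by rewrite /c ltrBlDr ltrDl exprn_gt0// invr_gt0.
have /eqO_exP[k k0 near_level] := glevel c 1 c0 c1 ltr01.
have eps1 : 1 - eps < 1 by rewrite gtrBl.
have eta3 : 0 < eta / 3 by rewrite divr_gt0.
have /eqoP/(_ _ eta3) near_reg := a_reg _ eps1.
near=> x.
have x1 : 1 < x by near: x; exact: nbhs_pinfty_gt.
have N0 : 0 < seqN a x by near: x; exact: seqN_near_gt0.
have lx : 0 < ln x by rewrite ln_gt0.
have lx1 : K' <= ln x by near: x; exact: near_ln_ge.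
have lx2 : 3 * m%:R * K' / eta <= ln x by near: x; exact: near_ln_ge.
have lx3 : 3 * k / eta <= ln x by near: x; exact: near_ln_ge.
have lev : `|\sum_(1 <= d < (Num.truncn (x `^ c)).+1) `|seqNd a d x - g d * seqN a x| |
    <= k * `|seqN a x / ln x `^ 1| by near: x; exact: near_level.
have reg : `|seqN a (x `^ (1 - eps))| <= eta / 3 * `|seqN a x|.
  by near: x; exact: near_reg.
have seqN_ge0 y : 0 <= seqN a y.
  by rewrite /seqN big_nat sumr_ge0// => i /andP[/a0].
rewrite !ger0_norm// in reg.
set y := x `^ (1 - eps) in reg.
have yx : y <= x.
  by rewrite /y -[leRHS]powRr1 ?(ltW (lt_trans ltr01 x1))// ler_powR ?ltW// gtrBl.
pose bs u := biased_sum x m (fun s => B (cells n x s) * (lprod s %| u)%:R).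
have pmf0 u : (0 < u)%N -> 0 <= pmf_u a x u by move=> /a0 ?; rewrite divr_ge0.
(* bs u is at most 1, and vanishes unless u \in E or u is small. *)
have S1 : \sum_(1 <= u < (Num.truncn x).+1) pmf_u a x u * bs u <= prob_u a x E + eta / 3.
  apply: le_trans (_ : _ <= prob_u a x E + seqN a y / seqN a x) _; last first.
    by rewrite lerD2l ler_pdivrMr.
  rewrite (le_seqN _ _ yx) ?powR_ge0// mulr_suml -big_split /=.
  rewrite big_nat [leRHS]big_nat; apply: ler_sum => u /andP[u0 ux].
  have {}ux : u%:R <= x by rewrite -truncn_ge_nat// (le_trans ler01)// ltW.
  rewrite [a u * _ / _]mulrAC -mulrDr; apply: ler_wpM2l; first exact: pmf0.
  have bs1 : bs u <= 1.
    apply: le_trans (biased_sum_dvd m u0 ux); apply: le_biased_sum; first exact: ltW.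
    by move=> s _; rewrite ler_piMl//; case/andP: (B01 (cells n x s)).
  have [uy|yu] := boolP (u%:R <= y); first by rewrite (le_trans bs1)// lerDr.
  rewrite addr0 indicE; have [uE|nuE] := boolP (u \in E); first exact: bs1.
  rewrite -[leRHS](biased_sum0 x m); apply: le_biased_sum; first exact: ltW.
  move=> s sA; have [su|_] := boolP (lprod s %| u)%N; last by rewrite mulr0.
  rewrite mulr1; have [->//|Bs] := eqVneq (B (cells n x s)) 0.
  move: nuE; rewrite notin_setE => -[].
  by apply: (BE x u s) => //; rewrite leNgt -/y; apply: contra yu => /ltW.
rewrite sum_pmf_biased_sum in S1.
have x0 : 0 <= x by rewrite ltW// (lt_trans ltr01).
have S2 : biased_sum x m (fun s => B (cells n x s) * g (lprod s)) - eta / 3 <=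
    biased_sum x m (fun s => B (cells n x s) * (seqNd a (lprod s) x / seqN a x)).
  pose r d := `|seqNd a d x - g d * seqN a x| / seqN a x.
  have rE : biased_sum x m (fun s => B (cells n x s) * r (lprod s)) <= eta / 3.
    apply: le_trans (_ : _ <= \sum_(1 <= d < (Num.truncn (x `^ c)).+1) r d) _.
      apply: biased_sum_error.
      - exact: ltW.
      - exact: powR_ge0.
      - by rewrite -[leRHS]powRr1//; apply: ler_powR; exact: ltW.
      - by move=> d; rewrite divr_ge0.
      - by [].
      - move=> s sA Bs.
        have vl := cells_in_cell (ltnW n1) x1 sA.
        have [sE _ _] := ratios_admissible x1 sA.
        have := residual_ge (ltnW n1) vl (Bn _ Bs).
        have -> : size (ratios x s) = m by rewrite size_ratios; case/and4P: sA => /eqP.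
        move=> resge; have sp : all prime s by case/and4P: sA.
        rewrite -ler_ln ?posrE ?ltr0n ?lprod_gt0// ?powR_gt0 ?(lt_trans ltr01)//.
        rewrite ln_powR /c mulrBl mul1r lerBrDr -lerBrDl sE mulrC.
        by rewrite ler_pM2l.
    rewrite -mulr_suml ler_pdivrMr//.
    apply: le_trans (ler_norm _) _; apply: le_trans lev _.
    rewrite powRr1 ?(ltW lx)// ger0_norm ?divr_ge0 ?(ltW lx)// mulrCA mulrC.
    rewrite ler_pM2r// ler_pdivrMr//.
    by rewrite ler_pdivrMr// in lx3; lra.
  rewrite lerBlDr; apply: le_trans (lerD (lexx _) rE).
  rewrite -lerBlDr -biased_sumB; apply: le_biased_sum => [|s sA]; first exact: ltW.
  rewrite -mulrBr ler_wpM2l// lerBlDr /r -mulrDl ler_pdivlMr//.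
  by rewrite addrC -lerBlDr -[leRHS]normrN opprB ler_norm.
have S3 := biased_sum_ge HK gM g0 n1 x1 lx1 (leqnn m) B0 Bn.
rewrite -/K' in S3.
have G0 : 0 <= grid_avg n m B.
  by rewrite -(grid_avg_cst m (0:R) (ltnW n1)) le_grid_avg.
have G1 : grid_avg n m B <= 1.
  rewrite -[leRHS](grid_avg_cst m (1:R) (ltnW n1)) le_grid_avg// => v _ _.
  by case/andP: (B01 v).
have t01 : 0 <= K' / ln x <= 1.
  by rewrite divr_ge0 ?(ltW lx)//= ler_pdivrMr// mul1r.
have bern := bernoulli_ineq m t01.
have mt : m%:R * (K' / ln x) <= eta / 3.
  by rewrite mulrA ler_pdivrMr//; rewrite ler_pdivrMr// in lx2; lra.
have : (1 - eta / 3) * grid_avg n m B <= (1 - K' / ln x) ^+ m * grid_avg n m B.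
  by rewrite ler_wpM2r//; lra.
nra.
Unshelve. all: by end_near.
Qed.

(** * The stick-breaking process on the grid *)

(** Words record 1 - U, so this is the set of U for which 1 - U lies in [i/n, (i+1)/n). *)
Definition grid_itv (R : realType) (n i : nat) : set R :=
  `]1 - i.+1%:R / n%:R, 1 - i%:R / n%:R]%classic.

Fixpoint grid_event (R : realType) (T : Type) (U : nat -> T -> R) (n m : nat)
    (b : seq nat -> bool) : set T :=
  if m is m'.+1 then
    \bigcup_(i < n) (U m' @^-1` grid_itv n i `&`
                     grid_event U n m' (fun v => b (i :: v)))
  else if b [::] then setT else set0.

Fixpoint fractions (R : realType) (u : nat -> R) (m : nat) : seq R :=
  if m is m'.+1 then 1 - u m' :: fractions u m' else [::].

Lemma size_fractions (R : realType) (u : nat -> R) m : size (fractions u m) = m.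
Proof. by elim: m => //= m ->. Qed.

Lemma residual_fractions (R : realType) (u : nat -> R) m :
  residual (fractions u m) = \prod_(i < m) u i.
Proof.
elim: m => [|m IH] /=; first by rewrite big_ord0.
by rewrite big_ord_recr /= IH subKr mulrC.
Qed.

Lemma sticks_fractions (R : realType) (u : nat -> R) m :
  sticks (fractions u m) = [seq stick_breaking u (m - i.+1) | i <- iota 0 m].
Proof.
elim: m => [//|m IH].
rewrite /= IH residual_fractions (iotaDl 1 0) -map_comp subSS subn0.
by congr cons; rewrite mulrC.
Qed.

Lemma grid_event_fractions (R : realType) (T : Type) (U : nat -> T -> R) n m b w :
  (0 < n)%N -> grid_event U n m b w ->
  exists v, [/\ b v, size v = m & all2 (in_cell n) v (fractions (U ^~ w) m)].
Proof.
move=> n0; have nR : (0 : R) < n%:R by rewrite ltr0n.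
elim: m b => [|m IH] b /=.
  by case: ifP => // b0 _; exists [::].
move=> [i /= iltn [+ /IH[v [bv sv vl]]]].
rewrite /grid_itv /= in_itv /= => /andP[U1 U2]; exists (i :: v); split => //=.
  by rewrite sv.
rewrite vl andbT /in_cell.
have : i.+1%:R / n%:R <= 1 :> R by rewrite ler_pdivrMr// mul1r ler_nat.
by move=> h; apply/andP; split; [apply/andP; split|]; lra.
Qed.

Lemma measurable_RV_preimage (R : realType) d (T : measurableType d)
    (P : probability T R) (X : {RV P >-> R}) (B : set R) :
  measurable B -> measurable (X @^-1` B).
Proof.
by move=> mB; rewrite -[X in measurable X]setTI; apply: measurable_funP.
Qed.

Lemma measurable_grid_event (R : realType) d (T : measurableType d)
    (P : probability T R) (U : nat -> {RV P >-> R}) n m b :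
  measurable (grid_event (fun j => U j : T -> R) n m b).
Proof.
elim: m b => [|m IH] b /=; first by case: ifP.
apply: bigcup_measurable => i _; apply: measurableI; last exact: IH.
by apply: measurable_RV_preimage; exact: measurable_itv.
Qed.

Lemma uniform_grid_itv (R : realType) n i : (i < n)%N ->
  uniform_prob (@ltr01 R) (@grid_itv R n i) = (n%:R^-1)%:E.
Proof.
move=> iltn; have nR : (0 : R) < n%:R by rewrite ltr0n (leq_ltn_trans _ iltn).
have i0 : 0 <= i%:R / n%:R :> R by rewrite divr_ge0// ltW.
have i1 : i.+1%:R / n%:R <= 1 :> R by rewrite ler_pdivrMr// mul1r ler_nat.
have ii : i.+1%:R / n%:R = i%:R / n%:R + n%:R^-1 :> R by rewrite -natr1 mulrDl mul1r.
have n'0 : 0 < n%:R^-1 :> R by rewrite invr_gt0.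
rewrite /uniform_prob (eq_integral (cst 1%E)); last first.
  move=> x; rewrite inE /grid_itv /= in_itv /= => /andP[x1 x2].
  rewrite /uniform_pdf ifT ?subr0 ?invr1//; apply/andP; split; lra.
rewrite integral_cst; last exact: measurable_itv.
rewrite mul1e /grid_itv /= lebesgue_measure_itv /= lte_fin.
by rewrite ifT; [rewrite -EFinB; congr EFin; lra | lra].
Qed.

(** The conditions on indices J beyond m make the induction close: unfolding the newest letter turns
    the condition on U m into one more member of J. *)
Lemma grid_event_indep (R : realType) d (T : measurableType d)
    (P : probability T R) (U : nat -> {RV P >-> R}) n m b (J : seq nat)
    (B : nat -> set R) :
  (0 < n)%N -> iid_uniform U -> uniq J -> (forall j, measurable (B j)) ->
  all (fun j => m <= j)%N J ->
  P (grid_event (fun j => U j : T -> R) n m b `&`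
     \bigcap_(j in [set` J]) (U j @^-1` B j)) =
  ((grid_avg n m (fun v => (b v)%:R))%:E *
   \prod_(j <- J) P (U j @^-1` B j))%E.
Proof.
move=> n0 [indep unif]; have nR : (0 : R) < n%:R by rewrite ltr0n.
elim: m b J B => [|m IH] b J B uJ mB mJ /=.
  case: (b [::]); first by rewrite setTI mul1e indep.
  by rewrite set0I measure0 mul0e.
have mR : measurable (\bigcap_(j in [set` J]) (U j @^-1` B j)).
  by apply: bigcap_measurableType => j _; exact: measurable_RV_preimage.
set Q := \bigcap_(j in _) _ in mR *.
pose F i := U m @^-1` grid_itv n i `&`
  grid_event (fun j => U j : T -> R) n m (fun v => b (i :: v)) `&` Q.
have mF i : measurable (F i).
  apply: measurableI => //; apply: measurableI; last exact: measurable_grid_event.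
  by apply: measurable_RV_preimage; exact: measurable_itv.
have tF : trivIset setT F.
  apply/trivIsetP => i j _ _ ij; apply/seteqP; split => // w.
  move=> [[[Ui _] _] [[Uj _] _]]; move/eqP: ij; apply.
  have trunc_i k : (U m w \in grid_itv n k) -> Num.truncn (n%:R * (1 - U m w)) = k.
    rewrite inE /grid_itv /= in_itv /= => /andP[].
    rewrite ltrBlDr -ltrBlDl lerBrDl -lerBrDr => h1 h2; apply: truncn_def.
    by rewrite mulrC -ler_pdivrMr// h2 -ltr_pdivlMr.
  by rewrite -(trunc_i i) ?inE// -(trunc_i j) ?inE.
rewrite setI_bigcupl (bigcup_mkord n F) (measure_bigsetU P mF tF).
have PF (i : 'I_n) : P (F i) =
    ((grid_avg n m (fun v => (b (nat_of_ord i :: v))%:R) / n%:R)%:E *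
    \prod_(j <- J) P (U j @^-1` B j))%E.
  pose B' j := if j == m then grid_itv n i else B j.
  have mJn : m \notin J by apply/negP => /(allP mJ); rewrite ltnn.
  have BB' j : j \in J -> B' j = B j.
    by move=> jJ; rewrite /B'; case: eqP => // jm; rewrite jm (negbTE mJn) in jJ.
  have -> : F i =
      grid_event (fun j => U j : T -> R) n m (fun v => b (nat_of_ord i :: v)) `&`
      \bigcap_(j in [set` m :: J]) (U j @^-1` B' j).
    rewrite /F [X in X `&` _]setIC -setIA; congr (_ `&` _).
    apply/seteqP; split => [w [Um wQ] j /=|w wQ].
      rewrite inE => /orP[/eqP ->|jJ]; first by rewrite /B' eqxx.
      by rewrite BB'//; exact: wQ.
    split; first by have := wQ m; rewrite /= inE eqxx /B' eqxx; exact.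
    by move=> j jJ /=; rewrite -BB'//; apply: wQ; rewrite /= inE (_ : j \in J) ?orbT.
  rewrite IH/= ?mJn ?leqnn//=; first last.
  - by apply/allP => j /(allP mJ) /ltnW.
  - by move=> j; rewrite /B'; case: ifP => // _; exact: measurable_itv.
  rewrite big_cons {1}/B' eqxx.
  have -> : P (U m @^-1` grid_itv n i) = (n%:R^-1)%:E.
    rewrite -(uniform_grid_itv R (ltn_ord i)) -(unif m); last exact: measurable_itv.
    by [].
  rewrite muleA -EFinM; congr (_ * _)%E.
  by apply: eq_big_seq => j jJ; rewrite BB'.
rewrite (eq_bigr _ (fun i _ => PF i)).
rewrite -ge0_sume_distrl; last first.
  move=> i _; rewrite lee_fin divr_ge0// -(grid_avg_cst m (0:R) n0).
  by apply: le_grid_avg.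
rewrite sumEFin; congr (_%:E * _)%E.
rewrite -mulr_suml mulrC grid_avgZ grid_avg_sum big_mkord.
by [].
Qed.

Lemma grid_event_prob (R : realType) d (T : measurableType d)
    (P : probability T R) (U : nat -> {RV P >-> R}) n m b :
  (0 < n)%N -> iid_uniform U ->
  P (grid_event (fun j => U j : T -> R) n m b) =
  (grid_avg n m (fun v => (b v)%:R))%:E.
Proof.
move=> n0 unif; have := @grid_event_indep R d T P U n m b [::] (fun=> setT) n0 unif isT.
rewrite big_nil mule1 => <- //.
by rewrite set_nil bigcap_set0 setIT.
Qed.

(** The first m sticks are within m/n <= tau of the sticks of the corner; every later stick is at
    most the product of the first m values of u, which the residual of the corner bounds. *)
Lemma rearrangement_few_large (R : realType) (k n m : nat) (c : 'I_k -> R)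
    (tau : R) (u L : nat -> R) (v : seq nat) :
  (0 < n)%N -> (forall j, 0 <= u j <= 1) ->
  nonincreasing_rearrangement (stick_breaking u) L ->
  size v = m -> all2 (in_cell n) v (fractions u m) ->
  clear_of n tau (codom c) v -> m%:R / n%:R <= tau ->
  (forall j, residual (corner R n v) <= c j) ->
  (forall j : 'I_k, L j <= c j) <-> few_large c (sticks (corner R n v)).
Proof.
move=> n0 u01 [Lmono [sigma [g gK sK] LE]] sv vu vclear mtau resc.
have prod_ge0 s : 0 <= \prod_(i < s) u i.
  by apply: prodr_ge0 => i _; case/andP: (u01 i).
(* g sends a stick to its rank; the index is reversed because words list the newest stick first. *)
pose pos := [seq g (m - i.+1)%N | i <- iota 0 m].
have spos : size pos = m by rewrite size_map size_iota.
apply: (@ranked_le_few_large _ _ _ _ _ _ pos tau) => //.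
- rewrite map_inj_in_uniq ?iota_uniq// => i j; rewrite !mem_iota add0n /=.
  by move=> im jm /(can_inj sK); lia.
- by rewrite spos.
- move=> i; rewrite sv => im.
  have -> : L (nth 0%N pos i) = nth 0 (sticks (fractions u m)) i.
    rewrite (nth_map 0%N) ?size_iota// nth_iota// add0n LE sK.
    by rewrite sticks_fractions (nth_map 0%N) ?size_iota// nth_iota.
  apply: le_trans (sticks_in_cell i n0 vu) _; first by rewrite size_fractions.
- move=> q qpos j; rewrite LE; apply: le_trans (resc j).
  have mq : (m <= sigma q)%N.
    rewrite leqNgt; apply: contra qpos => qm.
    apply/mapP; exists (m - (sigma q).+1)%N; first by rewrite mem_iota; lia.
    by rewrite -{1}(gK q); congr g; lia.
  have [_ /andP[resu _]] := residual_in_cell n0 vu.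
  apply: le_trans resu; rewrite residual_fractions /stick_breaking.
  rewrite -(subnKC mq); elim: (sigma q - m)%N => [|e IH].
    by rewrite addn0 ler_piMr ?prod_ge0//; case/andP: (u01 m); lra.
  have /andP[a0 a1] := u01 (m + e)%N; have /andP[b0 b1] := u01 (m + e.+1)%N.
  have Q0 := prod_ge0 (m + e)%N.
  have : \prod_(i < m + e.+1) u i <= \prod_(i < m) u i.
    elim: (e.+1) => [|e' IH']; first by rewrite addn0.
    rewrite addnS big_ord_recr /=; apply: le_trans IH'.
    by rewrite ler_piMr ?prod_ge0//; case/andP: (u01 (m + e')%N).
  by apply: le_trans; rewrite ler_piMr ?prod_ge0//; lra.
Qed.

Lemma probability_le_ae (R : realType) d (T : measurableType d)
    (P : probability T R) (A B : set T) : measurable A -> measurable B ->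
  {ae P, forall w, A w -> B w} -> (P A <= P B)%E.
Proof.
move=> mA mB AB.
have PD : P (A `\` B) = 0%E.
  apply: measure_negligible; first exact: measurableD.
  by apply: negligibleS AB => w [Aw nBw] /= /(_ Aw).
apply: le_trans (_ : _ <= P (B `|` (A `\` B)))%E _.
  rewrite le_measure// ?inE//; first exact: measurableU (measurableD _ _).
  by move=> w Aw /=; have [Bw|nBw] := pselect (B w); [left|right].
apply: (@le_trans _ _ (P B + P (A `\` B))%E); last by rewrite PD adde0.
by apply: measureU2 => //; exact: measurableD.
Qed.

Lemma uniform_itvoo01 (R : realType) :
  uniform_prob (@ltr01 R) `]0, 1[%classic = 1%E.
Proof.
rewrite /uniform_prob (eq_integral (cst 1%E)); last first.
  move=> x; rewrite inE /= in_itv /= => /andP[x1 x2].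
  by rewrite /uniform_pdf ifT ?subr0 ?invr1// (ltW x1) (ltW x2).
rewrite integral_cst; last exact: measurable_itv.
by rewrite mul1e /= lebesgue_measure_itv /= lte01 oppr0 adde0.
Qed.

Lemma iid_uniform_ae01 (R : realType) d (T : measurableType d)
    (P : probability T R) (U : nat -> {RV P >-> R}) : iid_uniform U ->
  {ae P, forall w, forall j, 0 < U j w < 1}.
Proof.
move=> [_ unif]; apply: ae_foralln => j.
have mU : measurable (U j @^-1` `]0, 1[%classic).
  by apply: measurable_RV_preimage; exact: measurable_itv.
have P1 : P (U j @^-1` `]0, 1[%classic) = 1%E.
  by rewrite -(uniform_itvoo01 R) -(unif j); last exact: measurable_itv.
exists (~` (U j @^-1` `]0, 1[%classic)); split.
- exact: measurableC.
- by have := probability_setC P mU; rewrite P1 subee.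
- by move=> w /= h; rewrite in_itv.
Qed.

Lemma measurable_ranked_le (R : realType) d (T : measurableType d)
    (P : probability T R) (L : nat -> {RV P >-> R}) k (c : 'I_k -> R) :
  measurable [set w | forall i : 'I_k, L i w <= c i].
Proof.
have -> : [set w | forall i : 'I_k, L i w <= c i] =
    \bigcap_(i in [set: 'I_k]) (L i @^-1` `]-oo, c i]%classic).
  apply/seteqP; split => w /=.
    by move=> h i _; rewrite /= in_itv /=.
  by move=> h i; have := h i Logic.I; rewrite /= in_itv /=.
apply: fin_bigcap_measurable => // i _.
by apply: measurable_RV_preimage; exact: measurable_itv.
Qed.

(** Such a word decides the event: listed entries stay on a definite side of each threshold,
    unlisted ones are too small to exceed any. *)
Definition word_good (R : realType) (n k : nat) (tau delta : R)
    (c : 'I_k -> R) (v : seq nat) : bool :=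
  clear_of n tau (codom c) v && (residual (corner R n v) <= delta).

Lemma grid_avg_le_poisson_dirichlet (R : realType) d (T : measurableType d)
    (P : probability T R) (L : nat -> {RV P >-> R}) (k n m : nat)
    (c : 'I_k -> R) (tau delta : R) :
  poisson_dirichlet_process L -> (0 < n)%N -> m%:R / n%:R <= tau ->
  (forall j, delta <= c j) ->
  let A := [set w | forall i : 'I_k, L i w <= c i] in
  grid_avg n m (fun v => (word_good n tau delta c v &&
                          few_large c (sticks (corner R n v)))%:R)
    <= fine (P A) /\
  grid_avg n m (fun v => (word_good n tau delta c v &&
                          ~~ few_large c (sticks (corner R n v)))%:R)
    <= 1 - fine (P A).
Proof.
move=> [U unif rearr] n0 mtau deltac A.
have mA : measurable A by exact: measurable_ranked_le.
have finA : P A \is a fin_num by exact: fin_num_measure.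
have U01 := iid_uniform_ae01 unif.
have key w v : nonincreasing_rearrangement
      (stick_breaking (fun j => U j w)) (fun j => L j w) ->
    (forall j, 0 < U j w < 1) -> word_good n tau delta c v -> size v = m ->
    all2 (in_cell n) v (fractions (fun j => U j w) m) ->
    A w <-> few_large c (sticks (corner R n v)).
  move=> rw Uw /andP[vclear vdelta] sv vU.
  apply: (rearrangement_few_large (u := fun j => U j w) (L := fun j => L j w)
                                  (m := m) (tau := tau)) => //.
  - by move=> j; have /andP[h1 h2] := Uw j; rewrite !ltW.
  - by move=> j; apply: le_trans (deltac j).
split; rewrite -lee_fin -(grid_event_prob _ _ n0 unif).
- rewrite fineK//; apply: probability_le_ae => //; first exact: measurable_grid_event.
  apply: filterS2 rearr U01 => w rw Uw /(grid_event_fractions n0)[v [/andP[vg vf] sv vU]].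
  by apply/(key w v rw Uw vg sv vU).
- rewrite EFinB fineK// -probability_setC//.
  apply: probability_le_ae; [exact: measurable_grid_event|exact: measurableC|].
  apply: filterS2 rearr U01 => w rw Uw /(grid_event_fractions n0)[v [/andP[vg vf] sv vU]].
  by move=> /(key w v rw Uw vg sv vU); apply/negP.
Qed.

(** * Ranked prime factors *)

Lemma mem_prime_factors u p : (p \in prime_factors u) = (p \in primes u).
Proof.
rewrite mem_sort prime_decompE -map_comp; apply/flatten_mapP/idP.
  by move=> [q qu /=]; rewrite mem_nseq => /andP[_ /eqP ->].
move=> pu; exists p => //=; rewrite mem_nseq eqxx andbT.
by move: pu; rewrite -logn_gt0.
Qed.

Lemma prod_prime_factors u : (0 < u)%N ->
  (\prod_(p <- prime_factors u) p = u)%N.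
Proof.
move=> u0; rewrite (perm_big _ (permEl (perm_sort _ _))) big_flatten big_map.
rewrite [RHS]prod_prime_decomp//; apply: eq_bigr => -[p e] _ /=.
by rewrite big_nseq iter_muln_1.
Qed.

Lemma prod_nth_dvd (s r : seq nat) : uniq r -> all (fun i => i < size s)%N r ->
  (\prod_(i <- r) nth 1%N s i %| \prod_(p <- s) p)%N.
Proof.
move=> ur /allP rs; rewrite [X in (_ %| X)%N](big_nth 1%N).
rewrite [X in (_ %| X)%N](bigID (fun i => i \in r)) /=.
have -> : (\prod_(0 <= i < size s | i \in r) nth 1 s i =
           \prod_(i <- r) nth 1 s i)%N; last exact: dvdn_mulr.
rewrite -big_filter; apply: perm_big; apply: uniq_perm => // [|i].
  by rewrite filter_uniq// iota_uniq.
rewrite mem_filter mem_index_iota /=.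
by apply/andP/idP => [[]//|ir]; rewrite ir rs.
Qed.

Lemma nth_prime_factor_gt0 u j : (0 < nth_prime_factor j u)%N.
Proof.
rewrite /nth_prime_factor; have [ju|uj] := ltnP j (size (prime_factors u)).
  have := mem_nth 1%N ju; rewrite mem_prime_factors mem_primes.
  by move=> /and3P[/prime_gt0].
by rewrite nth_default.
Qed.

Lemma nth_prime_factor_mono u i j : (i <= j)%N ->
  (nth_prime_factor j u <= nth_prime_factor i u)%N.
Proof.
move=> ij; have [ju|uj] := ltnP j (size (prime_factors u)); last first.
  by rewrite [nth_prime_factor j u]nth_default// nth_prime_factor_gt0.
have srt : sorted geq (prime_factors u).
  by apply: sort_sorted => a b; exact: leq_total.
have tr : transitive geq by move=> a b e ab bc; exact: leq_trans bc ab.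
exact: (sorted_leq_nth tr leqnn 1%N srt) (leq_ltn_trans ij ju) ju ij.
Qed.

(** Arithmetic counterpart of [rearrangement_few_large]. Passing from ln x to ln u moves each listed
    ratio by at most eps, which adds to the grid error m/n. *)
Lemma log_ratio_few_large (R : realType) (k n m : nat) (c : 'I_k -> R)
    (x eps tau delta : R) (u : nat) (s : seq nat) :
  (0 < n)%N -> 1 < x -> 0 < eps -> eps <= 2^-1 ->
  admissible x m s -> (0 < u)%N -> (lprod s %| u)%N ->
  x `^ (1 - eps) <= u%:R -> u%:R <= x ->
  clear_of n tau (codom c) (cells n x s) -> m%:R / n%:R + eps <= tau ->
  residual (corner R n (cells n x s)) <= delta ->
  (forall j, 2 * delta <= c j) ->
  (forall j : 'I_k, log_ratio R j u <= c j) <->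
  few_large c (sticks (corner R n (cells n x s))).
Proof.
move=> n0 x1 eps0 eps1 sA u0 su ux ux' vclear mtau resd deltac.
have lx : 0 < ln x by rewrite ln_gt0.
have x0 : 0 < x by rewrite (lt_trans ltr01).
have uR : (0 : R) < u%:R by rewrite ltr0n.
have lnu_ge : (1 - eps) * ln x <= ln u%:R.
  by rewrite -ln_powR ler_ln ?posrE// powR_gt0.
have lnu_le : ln u%:R <= ln x by rewrite ler_ln.
have lnu0 : 0 < ln u%:R :> R by apply: lt_le_trans lnu_ge; rewrite mulr_gt0//; lra.
have u1 : u != 1%N by apply: contraTneq lnu0 => ->; rewrite ln1 ltxx.
have [/eqP sz us sp _] := and4P sA.
have [DE stE _] := ratios_admissible x1 sA.
have vl := cells_in_cell n0 x1 sA.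
have [/andP[res0 _] /andP[res_le _]] := residual_in_cell n0 vl.
have sv : size (cells n x s) = m by rewrite size_map size_ratios.
have delta0 : 0 <= delta by apply: le_trans res0 (le_trans res_le resd).
have LE j : log_ratio R j u = ln (nth_prime_factor j u)%:R / ln u%:R.
  by rewrite /log_ratio (negbTE u1).
have s_pf p : p \in s -> p \in prime_factors u.
  move=> ps; rewrite mem_prime_factors mem_primes u0 (allP sp _ ps) /=.
  apply: dvdn_trans su; rewrite /lprod (big_rem p)//=; exact: dvdn_mulr.
pose pos := [seq index p (prime_factors u) | p <- s].
have upos : uniq pos.
  rewrite map_inj_in_uniq// => p q /s_pf pu /s_pf qu pq.
  by rewrite -(nth_index 1%N pu) pq nth_index.
apply: (@ranked_le_few_large _ _ _ _ (fun j => log_ratio R j u) _ pos tau) => //.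
- move=> i j ij; rewrite !LE ler_pM2r ?invr_gt0// ler_ln_nat//.
    exact: nth_prime_factor_gt0.
  exact: nth_prime_factor_mono.
- by rewrite size_map sz sv.
- move=> i; rewrite sv => im.
  apply: le_trans mtau; rewrite [leRHS]addrC.
  apply: le_trans (ler_distD (nth 0 (sticks (ratios x s)) i) _ _) _.
  apply: lerD; last first.
    by apply: le_trans (sticks_in_cell i n0 vl) _; rewrite size_ratios sz.
  rewrite stE (nth_map 0%N) ?sz// (nth_map 0%N) ?sz// LE /nth_prime_factor.
  set p := nth 0%N s i; have ps : p \in s by rewrite mem_nth ?sz.
  rewrite nth_index ?s_pf//.
  have pp : prime p by exact: (allP sp).
  have lp0 : 0 <= ln p%:R :> R by exact: ln_prime_ge0.
  have lpu : ln p%:R <= ln u%:R :> R.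
    rewrite ler_ln_nat ?prime_gt0// dvdn_leq//.
    by have := s_pf p ps; rewrite mem_prime_factors mem_primes => /and3P[].
  have -> : ln p%:R / ln u%:R - ln p%:R / ln x =
      (ln p%:R / ln u%:R) * ((ln x - ln u%:R) / ln x).
    by field; rewrite !gt_eqF.
  rewrite ger0_norm; last by rewrite mulr_ge0// divr_ge0 ?subr_ge0// ltW.
  rewrite -[leRHS]mul1r ler_pM// ?divr_ge0 ?subr_ge0 ?(ltW lx) ?(ltW lnu0)//.
    by rewrite ler_pdivrMr// mul1r.
  by rewrite ler_pdivrMr//; lra.
(* A prime p at an unlisted position, even a second copy of a listed one, satisfies p * lprod s | u,
   so ln p <= delta ln x; since ln u >= (ln x)/2, the ratio is at most 2 delta. *)
- move=> q qpos j; apply: le_trans (deltac j); rewrite LE.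
  have [qu|uq] := ltnP q (size (prime_factors u)); last first.
    by rewrite /nth_prime_factor nth_default// ln1 mul0r mulr_ge0.
  set p := nth_prime_factor q u; have p0 : (0 < p)%N := nth_prime_factor_gt0 u q.
  have psu : (p * lprod s %| u)%N.
    rewrite -[X in (_ %| X)%N](prod_prime_factors u0).
    have : uniq (q :: pos) by rewrite /= qpos.
    move=> /(@prod_nth_dvd (prime_factors u)); rewrite big_cons /= qu /=.
    have -> : (\prod_(i <- pos) nth 1 (prime_factors u) i = lprod s)%N.
      by rewrite big_map; apply: eq_big_seq => r /s_pf ru; rewrite nth_index.
    by apply; apply/allP => i /mapP[r /s_pf ru ->]; rewrite index_mem.
  have lnp : ln p%:R <= ln x - ln (lprod s)%:R.
    rewrite lerBrDr -lnM ?posrE ?ltr0n ?lprod_gt0// -natrM.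
    apply: le_trans lnu_le; rewrite ler_ln_nat ?muln_gt0 ?p0 ?lprod_gt0//.
    exact: dvdn_leq.
  rewrite DE in lnp; rewrite ler_pdivrMr//.
  have : ln x * residual (ratios x s) <= ln x * delta.
    by rewrite ler_pM2l//; apply: le_trans resd.
  have : 2 * delta * ((1 - eps) * ln x) <= 2 * delta * ln u%:R.
    by rewrite ler_wpM2l// mulr_ge0.
  have : 0 <= delta * ln x * (1 - 2 * eps) by rewrite !mulr_ge0// ?(ltW lx)//; lra.
  lra.
Qed.

(** * Convergence *)

Lemma geometric_3_4_le (R : realType) (M : R) : 0 < M ->
  exists2 m, (0 < m)%N & (3 / 4) ^+ m <= M.
Proof.
move=> M0; exists (Num.truncn (3 / M)).+1 => //.
set m := (Num.truncn _).+1.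
have m0 : (0 : R) < m%:R by rewrite ltr0n.
have mM : 3 <= m%:R * M.
  by rewrite -ler_pdivrMr// ltW// truncnS_gt.
(* Gives (3/4)^m <= 3/m; the shift by 3 makes the product nonincreasing, since (4 + j) * 3/4 <= 3 +
   j. *)
have : (3 + m%:R) * (3 / 4) ^+ m <= 3 :> R.
  elim: (m) => [|j IH]; first by rewrite expr0; lra.
  apply: le_trans IH; rewrite exprSr -(natr1 j).
  have : 0 <= (3 / 4) ^+ j * j%:R :> R by rewrite mulr_ge0// exprn_ge0//; lra.
  by move: ((3 / 4) ^+ j) (j%:R) => q r; lra.
have : 0 <= (3 / 4) ^+ m :> R by rewrite exprn_ge0//; lra.
move: ((3 / 4) ^+ m) => q q0 qm; rewrite -(ler_pM2l m0).
lra.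
Qed.

(** Union bound, with Markov's inequality for the residual. *)
Lemma grid_avg_not_word_good (R : realType) (n k m : nat) (c : 'I_k -> R)
    (tau delta c0 : R) :
  (1 < n)%N -> 0 < tau -> tau <= c0 / 2 -> 0 < delta ->
  (forall j, c0 <= c j) ->
  grid_avg n m (fun v => (~~ word_good n tau delta c v)%:R) <=
  m%:R * (n%:R^-1 + k%:R * (4 * tau / c0 + n%:R^-1)) + (3 / 4) ^+ m / delta.
Proof.
move=> n1 tau0 tauc delta0 c0c.
have ccs : all (fun t => c0 <= t) (codom c) by apply/allP => _ /codomP[j ->].
have := grid_avg_not_clear m n1 tau0 tauc ccs; rewrite size_codom card_ord => h1.
have h2 := grid_avg_residual R m n1.
apply: le_trans (_ : _ <= grid_avg n m (fun v =>
  (~~ clear_of n tau (codom c) v)%:R + delta^-1 * residual (corner R n v))) _.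
  apply: le_grid_avg => v _ vn; rewrite /word_good negb_and.
  have /andP[r0 _] := residual_corner01 R (ltnW n1) vn.
  have r0' : 0 <= delta^-1 * residual (corner R n v) by rewrite mulr_ge0 ?invr_ge0 ?ltW.
  case: (clear_of _ _ _ _) => /=; last by rewrite lerDl.
  rewrite add0r; have [//|] := leP (residual _) delta => dr /=.
  by rewrite mulrC ler_pdivlMr// mul1r ltW.
rewrite grid_avgD grid_avgZ; apply: lerD => //.
by rewrite mulrC ler_pM2r ?invr_gt0.
Qed.

(** The order of choice matters: delta from the thresholds, m from delta, tau from m, then n and eps
    from m and tau. Each of the three error terms gets eta/3. *)
Lemma word_good_parameters (R : realType) (k : nat) (c : 'I_k -> R) (eta : R) :
  0 < eta -> (forall j, 0 < c j) ->
  exists n m tau delta eps,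
    [/\ (1 < n)%N && (0 < m)%N, 0 < eps <= 2^-1, m%:R / n%:R + eps <= tau,
        forall j, 2 * delta <= c j
      & 1 - eta <= grid_avg n m (fun v => (word_good n tau delta c v)%:R)].
Proof.
move=> eta0 cpos.
pose c0 := \big[Num.min/1]_(j < k) c j.
have c00 : 0 < c0 by apply: lt_bigmin.
have c0c j : c0 <= c j by apply: bigmin_le.
pose delta := c0 / 2; have delta0 : 0 < delta by rewrite /delta; lra.
have eta3 : 0 < eta / 3 by lra.
have [m m0 mle] := geometric_3_4_le (mulr_gt0 eta3 delta0).
have mR : (0 : R) < m%:R by rewrite ltr0n.
pose mk := m%:R * (1 + k%:R) : R.
have mk0 : 0 < mk by rewrite mulr_gt0// ltr_wpDr.
(* The entries serve, in turn, the hypothesis of [grid_avg_not_word_good], the sticks near a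
   threshold, and eps = tau/2 <= 1/2. *)
pose tau := Num.min (Num.min (c0 / 2) (eta / 3 * c0 / (4 * mk))) 1.
have tau0 : 0 < tau.
  rewrite !lt_min ltr01 andbT; apply/andP; split; first lra.
  by rewrite divr_gt0 ?mulr_gt0.
have tau1 : tau <= c0 / 2 by rewrite !ge_min lexx.
have tau2 : tau <= eta / 3 * c0 / (4 * mk) by rewrite !ge_min lexx orbT.
have tau3 : tau <= 1 by rewrite !ge_min lexx orbT.
pose n := (Num.truncn (Num.max (2 * m%:R / tau) (3 * mk / eta))).+2.
have nR : (0 : R) < n%:R by rewrite ltr0n.
have nmax : Num.max (2 * m%:R / tau) (3 * mk / eta) <= n%:R.
  by apply: le_trans (ltW (truncnS_gt _)) _; rewrite ler_nat.
have n1 : 2 * m%:R / tau <= n%:R by apply: le_trans nmax; rewrite le_max lexx.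
have n2 : 3 * mk / eta <= n%:R by apply: le_trans nmax; rewrite le_max lexx orbT.
exists n, m, tau, delta, (tau / 2); split => //.
- by apply/andP; split; lra.
- suff : m%:R / n%:R <= tau / 2 by lra.
  by rewrite ler_pdivrMr//; rewrite ler_pdivrMr// in n1; lra.
- by move=> j; have := c0c j; rewrite /delta; lra.
have := @grid_avg_not_word_good _ n k m c tau delta c0 isT tau0 tau1 delta0 c0c.
have : (3 / 4) ^+ m / delta <= eta / 3 by rewrite ler_pdivrMr.
have : mk / n%:R <= eta / 3.
  by rewrite ler_pdivrMr//; rewrite ler_pdivrMr// in n2; lra.
have : mk * (4 * tau / c0) <= eta / 3.
  rewrite ler_pdivlMr ?mulr_gt0// in tau2.
  by rewrite !mulrA ler_pdivrMr//; lra.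
have : m%:R * (k%:R * (4 * tau / c0)) <= mk * (4 * tau / c0).
  rewrite mulrA ler_wpM2r ?divr_ge0 ?mulr_ge0 ?(ltW c00) ?(ltW tau0)//.
  by rewrite /mk ler_wpM2l// lerDr.
have -> : m%:R * (n%:R^-1 + k%:R * (4 * tau / c0 + n%:R^-1)) =
    mk / n%:R + m%:R * (k%:R * (4 * tau / c0)) by rewrite /mk; ring.
move=> h1 h2 h3 h4 h5.
suff : 1 = grid_avg n m (fun v => (word_good n tau delta c v)%:R) +
    grid_avg n m (fun v => (~~ word_good n tau delta c v)%:R) :> R by lra.
rewrite -grid_avgD -[LHS](grid_avg_cst m (1 : R) (ltn0Sn _ : 0 < n)%N).
congr grid_avg; apply/funext => v.
by case: word_good; rewrite /= ?addr0 ?add0r.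
Qed.

Lemma prob_uC (R : realType) (a : nat -> R) (x : R) (E : set nat) :
  0 < seqN a x -> prob_u a x E + prob_u a x (~` E) = 1.
Proof.
move=> N0; rewrite /prob_u -big_split /=.
rewrite (eq_bigr (fun u => a u / seqN a x)); last first.
  move=> u _; rewrite -mulrDr !indicE in_setC.
  by case: (u \in E); rewrite /= ?addr0 ?add0r mulr1.
by rewrite -mulr_suml -/(seqN a x) mulfV ?gt_eqF.
Qed.

Lemma le_prob_u (R : realType) (a : nat -> R) (x : R) (E F : set nat) :
  (forall n : nat, (0 < n)%N -> 0 <= a n) -> 0 < seqN a x ->
  E `<=` F -> prob_u a x E <= prob_u a x F.
Proof.
move=> a0 N0 EF; rewrite /prob_u big_nat [leRHS]big_nat; apply: ler_sum => u /andP[u0 _].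
apply: ler_wpM2l; first by rewrite divr_ge0 ?a0// ltW.
rewrite !indicE; have [uE|_] := boolP (u \in E); last by [].
by rewrite (_ : u \in F)// inE; apply: EF; rewrite -in_setE.
Qed.

Lemma prob_u_ge0 (R : realType) (a : nat -> R) (x : R) (E : set nat) :
  (forall n : nat, (0 < n)%N -> 0 <= a n) -> 0 < seqN a x ->
  0 <= prob_u a x E.
Proof.
move=> a0 N0; rewrite /prob_u big_nat sumr_ge0// => u /andP[u0 _].
by rewrite mulr_ge0// divr_ge0 ?a0// ltW.
Qed.

Lemma prob_u_cvg_pos (R : realType) (a : nat -> R)
    (a_ge0 : forall n : nat, (0 < n)%N -> 0 <= a n)
    (a_neq0 : exists2 n : nat, (0 < n)%N & 0 < a n)
    (a_regular : regular_seq a)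
    (a_level : has_level_of_distribution a 1)
    (d : measure_display) (T : measurableType d) (P : probability T R)
    (L : nat -> {RV P >-> R}) (L_PD : poisson_dirichlet_process L)
    (k : nat) (c : 'I_k -> R) (c_gt0 : forall i : 'I_k, 0 < c i) :
  prob_u a x [set u | forall i : 'I_k, log_ratio R i u <= c i] @[x --> +oo] -->
  fine (P [set w | forall i : 'I_k, L i w <= c i]).
Proof.
set A := [set u | _]; set p := fine _.
(* Both probabilities lie between avg B1 - eta and 1 - avg B2 + eta, with p even within the bounds
   without eta. As avg B1 + avg B2 >= 1 - eta, they differ by at most 2 eta = e. *)
apply/cvgrPdist_le => e e0; pose eta := e / 2.
have eta0 : 0 < eta by rewrite /eta; lra.
have [n [m [tau [delta [eps [/andP[n1 m0] /andP[eps0 eps1] mtau dc avg]]]]]] :=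
  word_good_parameters eta0 c_gt0.
have n0 := ltnW n1.
have [] := @grid_avg_le_poisson_dirichlet R d T P L k n m c tau delta L_PD n0.
- by apply: le_trans mtau; lra.
- move=> j; have := dc j; have := c_gt0 j; lra.
rewrite -/p; set B1 := fun v => _; set B2 := fun v => _ => avg1 avg2.
have avgE : grid_avg n m (fun v => (word_good n tau delta c v)%:R) =
    grid_avg n m B1 + grid_avg n m B2.
  rewrite -grid_avgD; congr grid_avg; apply/funext => v.
  rewrite /B1 /B2; case: word_good => /=; last by rewrite addr0.
  by case: few_large; rewrite /= ?addr0 ?add0r.
have natb (b : bool) : (b%:R : R) != 0 -> b by case: b; rewrite ?eqxx.
have b01 (b : bool) : 0 <= (b%:R : R) <= 1 by case: b; rewrite lexx ler01.
have link x u s : 1 < x -> (0 < u)%N -> x `^ (1 - eps) <= u%:R -> u%:R <= x ->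
    admissible x m s -> (lprod s %| u)%N -> word_good n tau delta c (cells n x s) ->
    A u <-> few_large c (sticks (corner R n (cells n x s))).
  move=> x1 u0 ux ux' sA su /andP[vclear vd].
  exact: (@log_ratio_few_large R k n m c x eps tau delta u s).
have near1 : \forall x \near +oo, grid_avg n m B1 - eta <= prob_u a x A.
  apply: (@prob_u_liminf R a n m B1 A eps eta) => //.
  - by move=> v; exact: b01.
  - by move=> v /natb/andP[/andP[/clear_of_letters]].
  - by move=> x u s x1 u0 ux ux' sA su /natb/andP[vg vf]; apply/(link x u s).
have near2 : \forall x \near +oo, grid_avg n m B2 - eta <= prob_u a x (~` A).
  apply: (@prob_u_liminf R a n m B2 (~` A) eps eta) => //.
  - by move=> v; exact: b01.
  - by move=> v /natb/andP[/andP[/clear_of_letters]].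
  - move=> x u s x1 u0 ux ux' sA su /natb/andP[vg vf] /(link x u s x1 u0 ux ux' sA su vg).
    exact/negP.
have near3 := seqN_near_gt0 a_ge0 a_neq0.
apply: filterS3 near1 near2 near3 => x h1 h2 /(prob_uC A) h3.
by rewrite ler_norml; apply/andP; split; rewrite /eta in avg h1 h2; lra.
Qed.

(** Makes the limiting event null as soon as one threshold is 0. *)
Lemma poisson_dirichlet_gt0 (R : realType) (d : measure_display)
    (T : measurableType d) (P : probability T R) (L : nat -> {RV P >-> R}) :
  poisson_dirichlet_process L -> {ae P, forall w, forall j, 0 < L j w}.
Proof.
move=> [U /iid_uniform_ae01 U01]; apply: filterS2 U01 => w Uw.
move=> [_ [sigma _ LE]] j; rewrite LE /stick_breaking.
apply: mulr_gt0; last by rewrite subr_gt0; case/andP: (Uw (sigma j)).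
by apply: prodr_gt0 => i _; case/andP: (Uw i).
Qed.

Theorem theorem1p6 (R : realType) (a : nat -> R)
    (a_ge0 : forall n : nat, (0 < n)%N -> 0 <= a n)
    (a_neq0 : exists2 n : nat, (0 < n)%N & 0 < a n)
    (a_regular : regular_seq a)
    (a_level : has_level_of_distribution a 1)
    (d : measure_display) (T : measurableType d) (P : probability T R)
    (L : nat -> {RV P >-> R}) (L_PD : poisson_dirichlet_process L)
    (k : nat) (k_gt0 : (0 < k)%N)
    (c : 'I_k -> R) (c_ge0 : forall i : 'I_k, 0 <= c i) :
  prob_u a x [set u | forall i : 'I_k, log_ratio R i u <= c i] @[x --> +oo] -->
  fine (P [set w | forall i : 'I_k, L i w <= c i]).
Proof.
have [c_gt0|] := pselect (forall i, 0 < c i); first exact: prob_u_cvg_pos.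
move=> /existsNP[j /negP]; rewrite -leNgt => cj0.
pose A (b : 'I_k -> R) := [set w | forall i : 'I_k, L i w <= b i].
have mA b : measurable (A b) by exact: measurable_ranked_le.
have PA0 : P (A c) = 0%E.
  apply/eqP; rewrite eq_le measure_ge0 andbT -(measure0 P).
  apply: probability_le_ae => //; apply: filterS (poisson_dirichlet_gt0 L_PD).
  by move=> w Lw /(_ j); rewrite leNgt (le_lt_trans cj0).
rewrite -/(A c) PA0 /=; apply/cvgrPdist_le => e e0.
(* The limit is 0; bound the thresholds below by positive numbers to reduce to
   the previous case. *)
pose ct (i : nat) : 'I_k -> R := fun l => Num.max (c l) i.+1%:R^-1.
have AE : \bigcap_i A (ct i) = A c.
  apply/seteqP; split => w; last first.
    by move=> h i _ l; rewrite le_max h.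
  move=> h l; apply/ler_addgt0Pr => t t0.
  pose i := Num.truncn t^-1.
  have it : i.+1%:R^-1 <= t by rewrite invf_ple ?posrE// ltW// truncnS_gt.
  have := h i Logic.I l; rewrite /ct le_max => /orP[] Ll; apply: le_trans Ll _.
    by rewrite lerDl ltW.
  by apply: le_trans it _; rewrite lerDr.
have mAct : measurable (\bigcap_i A (ct i)) by rewrite AE.
(* Continuity of P from above along events decreasing to the null event [A c]. *)
have : (P \o (A \o ct)) x @[x --> \oo] --> P (\bigcap_i A (ct i)).
  apply: nonincreasing_cvg_mu => //.
  - exact: le_lt_trans (probability_le1 P (mA (ct 0%N))) (ltry _).
  - by move=> i; exact: mA.
  - move=> i l il; apply/subsetPset => w h q; apply: le_trans (h q) _.
    by rewrite /ct ge_max !le_max lexx /= lef_pV2 ?posrE// ler_nat ltnS il orbT.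
rewrite AE PA0 => /fine_cvgP[_ /cvgrPdist_lt/(_ (e / 2))].
have e2 : 0 < e / 2 by lra.
move=> /(_ e2)[N _ /(_ N (leqnn _))] /=; rewrite sub0r normrN => PN.
have ct_gt0 l : 0 < ct N l by rewrite lt_max invr_gt0 ltr0n orbT.
have /cvgrPdist_lt/(_ _ e2) near1 :=
  prob_u_cvg_pos a_ge0 a_neq0 a_regular a_level L_PD ct_gt0.
have near2 := seqN_near_gt0 a_ge0 a_neq0.
apply: filterS2 near1 near2 => x h1 N0.
rewrite sub0r normrN ger0_norm ?prob_u_ge0//.
apply: le_trans (_ : _ <= prob_u a x
  [set u | forall i : 'I_k, log_ratio R i u <= ct N i]) _.
  by apply: le_prob_u => // u h i; rewrite /ct le_max h.
by move: h1 PN; rewrite !ltr_norml => /andP[h1 h2] /andP[h3 h4]; lra.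
Qed.
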